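(* Let $n\ge 1$. An algebraic subset of $\mathbb R^n$ induced by a polynomial $P\in\mathbb C[X_1,\ldots,X_n]$ is of type A if and only if it is of type B.
   Context: $\mathbb C[X_1,\ldots,X_n]$ is regarded as a $*$-algebra with involution $(R+\mathrm iS)^*=R-\mathrm iS$ for $R,S\in\mathbb R[X_1,\ldots,X_n]$ (so $X_j^*=X_j$). For $P\in\mathbb C[X_1,\ldots,X_n]$, let $\mathcal Z_P=\{x\in\mathbb R^n: P(x)=0\}$ (real zeros only) and let $(P)_{\mathsf c}$ be the ideal of $\mathbb C[X_1,\ldots,X_n]$ generated by $P$. The set $V=\mathcal Z_P$ is called the algebraic subset of $\mathbb R^n$ induced by $P$. For $Z\subset\mathbb R^n$, let $\mathcal I_{\mathsf c}(Z)=\{R\in\mathbb C[X_1,\ldots,X_n]: R(x)=0\text{ for every }x\in Z\}$. A complex linear functional $\Lambda:\mathbb C[X_1,\ldots,X_n]\to\mathbb C$ is positive definite if $\Lambda(R^*R)\ge0$ for all $R$. It is a moment functional if there is a positive Borel measure $\mu$ on $\mathbb R^n$, with respect to which all polynomials are absolutely integrable, such that $\Lambda(R)=\int_{\mathbb R^n}R\,d\mu$ for all $R\in\mathbb C[X_1,\ldots,X_n]$. A polynomial $P\in\mathbb C[X_1,\ldots,X_n]$ is of type A (respectively, type B) if every positive definite complex linear functional on $\mathbb C[X_1,\ldots,X_n]$ vanishing on $(P)_{\mathsf c}$ (respectively, on $\mathcal I_{\mathsf c}(\mathcal Z_P)$) is a moment functional. The algebraic set $V=\mathcal Z_P$ is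 of type A (respectively, type B) if $P$ is of type A (respectively, type B); these properties do not depend on the choice of the polynomial $P$ inducing $V$. *)

(* Defs.v *)
From HB Require Import structures.
From mathcomp Require Import all_boot all_order all_algebra.
From mathcomp Require Import all_classical all_reals all_analysis.
From mathcomp Require Import complex.
(* The notations of mpoly clash with those of mathcomp-analysis. *)
From mathcomp Require Import -(notations) mpoly.

Set Implicit Arguments.
Unset Strict Implicit.
Unset Printing Implicit Defensive.

Import Order.TTheory GRing.Theory Num.Theory.
Import numFieldNormedType.Exports.

Local Open Scope classical_set_scope.
Local Open Scope ring_scope.

Notation cpoly R n := (mpoly n (complex R)).

(* The Borel sigma-algebra of R^n is generated by the open sets. *)
Definition borel_space (R : realType) (n : nat) :=
  g_sigma_algebraType (@open 'rV[R]_n).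

Section Defs.
Context {R : realType} {n : nat}.
Implicit Types (P Q : cpoly R n) (Z : set 'rV[R]_n).

Definition eval_real Q (x : 'rV[R]_n) : R[i] :=
  meval (fun j => (x 0 j)%:C%C) Q.

(* Conjugating the coefficients is (S + iT)^* = S - iT for S, T with real
   coefficients. *)
Definition star Q : cpoly R n := map_mpoly Num.conj Q.

Definition real_zeros P : set 'rV[R]_n := [set x | eval_real P x = 0].

Definition principal_ideal P : set (cpoly R n) :=
  [set S * P | S in [set: cpoly R n]].

Definition vanishing_ideal Z : set (cpoly R n) :=
  [set Q | forall x, Z x -> eval_real Q x = 0].

Implicit Type Lambda : {scalar cpoly R n}.

(* In the order of R[i], [0 <= z] means that z is real and nonnegative. *)
Definition positive_definite Lambda : Prop :=
  forall Q, 0 <= Lambda (star Q * Q).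

(* A complex function is absolutely integrable when its real and imaginary
   parts are; its integral is then taken componentwise. *)
Definition complex_integrable (mu : {measure set (borel_space R n) -> \bar R})
    (f : 'rV[R]_n -> R[i]) : Prop :=
  mu.-integrable [set: borel_space R n] (fun x => (complex.Re (f x))%:E) /\
  mu.-integrable [set: borel_space R n] (fun x => (complex.Im (f x))%:E).

Definition complex_integral (mu : {measure set (borel_space R n) -> \bar R})
    (f : 'rV[R]_n -> R[i]) : R[i] :=
  Complex (Rintegral mu [set: borel_space R n] (fun x => complex.Re (f x)))
          (Rintegral mu [set: borel_space R n] (fun x => complex.Im (f x))).

Definition moment_functional Lambda : Prop :=
  exists mu : {measure set (borel_space R n) -> \bar R},
    (forall Q, complex_integrable mu (eval_real Q)) /\
    (forall Q, Lambda Q = complex_integral mu (eval_real Q)).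

Definition vanishes_on Lambda (I : set (cpoly R n)) : Prop :=
  forall Q, I Q -> Lambda Q = 0.

Definition type_A P : Prop :=
  forall Lambda, positive_definite Lambda ->
    vanishes_on Lambda (principal_ideal P) -> moment_functional Lambda.

Definition type_B P : Prop :=
  forall Lambda, positive_definite Lambda ->
    vanishes_on Lambda (vanishing_ideal (real_zeros P)) ->
    moment_functional Lambda.

End Defs.

(* Main.v *)
Require Import Defs.
From HB Require Import structures.
From mathcomp Require Import all_boot all_order all_algebra.
From mathcomp Require Import all_classical all_reals all_analysis.
From mathcomp Require Import complex.
From mathcomp Require Import -(notations) mpoly.
From mathcomp Require Import ring lra zify.
From mathcomp Require Import polyrcf.

(** Type A implies type B because (P) is contained in I(Z_P). Conversely, let Lambda be
    positive definite and vanish on (P). By Cauchy-Schwarz the real polynomials t with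
    Lambda(t^2) = 0 form a real ideal J containing P^*P, and Lambda vanishes on J. If f is a
    real polynomial outside J, then (Zorn) some ordering of a residue field of R[X] kills
    P^*P but not f. By the Artin-Lang theorem there is a point x of R^n at which P^*P
    vanishes but f does not, so f does not vanish on Z_P. Hence Lambda vanishes on I(Z_P).

    The Artin-Lang theorem is proved one variable at a time, without real closures. Given a
    finite family of polynomials in one variable over a ring A, close it under derivatives
    and pseudo-remainders. Over an ordered field in which the members of the family have the
    intermediate value property, the signs of the coefficients determine which sign vectors
    the family realizes on the line and in which order (Thom's lemma and the Cohen-Hormander
    elimination). An ordered field acquires the intermediate value property for the family
    by adjoining roots at sign changes as long as possible. *)

Set Implicit Arguments.
Unset Strict Implicit.
Unset Printing Implicit Defensive.

Import Order.TTheory GRing.Theory Num.Theory.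

Local Open Scope classical_set_scope.
Local Open Scope ring_scope.

(** * Ordered fields from preorderings *)

Lemma fraction_ratioP (R : idomainType) (z : {fraction R}) :
  exists n d : R, d != 0 /\ z = FracField.tofrac n / FracField.tofrac d.
Proof.
elim/(@quotW _ {fraction R}): z => r; exists (frac r).1, (frac r).2.
split; first exact: denom_ratioP.
apply: (canRL (mulfK _)); first by rewrite tofrac_eq0 denom_ratioP.
rewrite !piE; apply/eqP; rewrite /= FracField.equivf_def /FracField.mulf.
rewrite !numden_Ratio ?mulf_neq0 ?oner_neq0 ?denom_ratioP//.
by rewrite !mulr1 mulrC.
Qed.

Definition preordering (B : comNzRingType) (T : set B) : Prop :=
  [/\ forall a b, T a -> T b -> T (a + b),
      forall a b, T a -> T b -> T (a * b) &
      forall a, T (a ^+ 2)].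

Section PrimeCone.
Variables (B : comNzRingType) (T : set B) (f : B).

(** For m = 0 it says that - 1 is not in M; for m = 1 it keeps f out of the support of a cone.
    Taking all powers makes the condition compatible with the products formed in
    [exists_prime_cone]. *)
Definition avoids_powers (M : set B) := forall m, ~ M (- (f ^+ m) ^+ 2).

Lemma maximal_preordering : preordering T -> avoids_powers T ->
  exists M : set B, [/\ T `<=` M, preordering M, avoids_powers M &
    forall N : set B, M `<=` N -> preordering N -> avoids_powers N -> N = M].
Proof.
move=> TT fT.
pose P (N : set B) := N = set0 \/ [/\ T `<=` N, preordering N & avoids_powers N].
have [F FP Ftot|M [PM Mmax]] := @Zorn_bigcup B P.
  have [[N [FN [x Nx]]]|Fempty] := pselect (exists N, F N /\ exists x, N x); last first.
    left; apply/seteqP; split=> // x [N FN Nx]; apply: Fempty.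
    by exists N; split=> //; exists x.
  have NP K y : F K -> K y -> [/\ T `<=` K, preordering K & avoids_powers K].
    by move=> FK Ky; case: (FP K FK) => // K0; rewrite K0 in Ky.
  have both a b : (\bigcup_(X in F) X) a -> (\bigcup_(X in F) X) b ->
      exists K, [/\ F K, K a & K b].
    move=> [K FK Ka] [K' FK' Kb]; have [KK'|K'K] := Ftot _ _ FK FK'.
      by exists K'; split=> //; apply: KK'.
    by exists K; split=> //; apply: K'K.
  right; split.
  - by move=> t Tt; exists N => //; have [TN _ _] := NP _ _ FN Nx; apply: TN.
  - split.
    + move=> a b /both /[apply] [[K [FK Ka Kb]]]; exists K => //.
      by have [_ [KD _ _] _] := NP _ _ FK Ka; apply: KD.
    + move=> a b /both /[apply] [[K [FK Ka Kb]]]; exists K => //.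
      by have [_ [_ KM _] _] := NP _ _ FK Ka; apply: KM.
    + by move=> a; exists N => //; have [_ [_ _ NS] _] := NP _ _ FN Nx.
  - by move=> m [K FK Km]; have [_ _ /(_ m)] := NP _ _ FK Km.
have T1 : T 1 by rewrite -(expr1n _ 2); case: TT.
have [TM MM fM] : [/\ T `<=` M, preordering M & avoids_powers M].
  case: PM => // M0; exfalso; apply: (Mmax T); last by right; split.
  by rewrite M0; split=> [x|/(_ 1 T1)].
exists M; split=> // N MN NN fN; apply/eqP/negPn/negP => /eqP NM.
apply: (Mmax N); last by right; split=> //; exact: subset_trans MN.
by split=> // NM'; apply: NM; apply/seteqP.
Qed.

End PrimeCone.

(** A point of the real spectrum of B: a prime ideal, formed by the a with both a and - a in M,
    together with an ordering of its residue field. *)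
Record prime_cone (B : comNzRingType) (M : set B) : Prop := PrimeCone {
  pcone_preordering : preordering M;
  pcone_total : forall a, M a \/ M (- a);
  pcone_proper : ~ M (- 1);
  pcone_prime : forall a b, M (a * b) -> M (- (a * b)) ->
    (M a /\ M (- a)) \/ (M b /\ M (- b)) }.

(** A maximal preordering avoiding the powers of f will do: a failure of totality or primality
    yields two witnesses whose product puts some [- (f ^+ (m + k)) ^+ 2] in M. *)
Lemma exists_prime_cone (B : comNzRingType) (T : set B) (f : B) :
  preordering T -> avoids_powers f T ->
  exists M : set B, [/\ T `<=` M, prime_cone M & ~ (M f /\ M (- f))].
Proof.
move=> TT fT; have [M [TM MM fM Mmax]] := maximal_preordering TT fT.
have [MD MX MS] := MM.
have M1 : M 1 by rewrite -(expr1n _ 2).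
have M0 : M 0 by have := MS 0; rewrite expr0n.
(* M + aM is again a preordering and contains a, so by maximality it no longer avoids the powers of
   f. *)
have witness a : ~ M a -> exists s t m, [/\ M s, M t & - (f ^+ m) ^+ 2 = s + a * t].
  move=> nMa; apply: contrapT => nw; apply: nMa.
  pose N := [set x | exists s t, [/\ M s, M t & x = s + a * t]].
  rewrite -(Mmax N).
  - by exists 0, 1; rewrite add0r mulr1.
  - by move=> x Mx; exists x, 0; rewrite mulr0 addr0.
  - split.
    + move=> _ _ [s [t [Ms Mt ->]]] [s' [t' [Ms' Mt' ->]]].
      by exists (s + s'), (t + t'); split; [exact: MD|exact: MD|ring].
    + move=> _ _ [s [t [Ms Mt ->]]] [s' [t' [Ms' Mt' ->]]].
      exists (s * s' + a ^+ 2 * (t * t')), (s * t' + s' * t).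
      split; [|exact: MD (MX _ _ Ms Mt') (MX _ _ Ms' Mt)|ring].
      exact: MD (MX _ _ Ms Ms') (MX _ _ (MS a) (MX _ _ Mt Mt')).
    + by move=> x; exists (x ^+ 2), 0; split=> //; rewrite mulr0 addr0.
  - by move=> m [s [t [Ms Mt e]]]; apply: nw; exists s, t, m.
exists M; split=> //; last first.
  by move=> [Mf Mnf]; apply: (fM 1%N); rewrite expr1 expr2 -mulNr; exact: MX.
split=> //.
- move=> a; apply: contrapT => /not_orP[/witness[s [t [m [Ms Mt e]]]]].
  move=> /witness[u [v [k [Mu Mv e']]]]; apply: (fM (m + k)%N).
  (* This is the product of a t = - (f^(2m) + s) and a v = f^(2k) + u. *)
  suff -> : - (f ^+ (m + k)) ^+ 2 = (f ^+ m) ^+ 2 * u + (f ^+ k) ^+ 2 * s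
        + s * u + a ^+ 2 * (t * v).
    apply: (MD); last by apply: (MX _ _ (MS _)); apply: MX.
    apply: (MD); last exact: MX.
    by apply: (MD); apply: (MX _ _ (MS _)).
  have -> : u = - (f ^+ k) ^+ 2 + a * v by rewrite e' mulNr subrK.
  have -> : s = - (f ^+ m) ^+ 2 - a * t by rewrite e addrK.
  by rewrite exprD; ring.
- by move=> M1'; apply: (fM 0%N); rewrite expr0 expr1n.
(* The two witnesses are multiplied again, with - a b in M in place of the square a^2. Changing the
   signs of a and b covers the four cases. *)
- have no_neg a b : M (- (a * b)) -> ~ M a -> ~ M b -> False.
    move=> Mnab /witness[s [t [m [Ms Mt e]]]] /witness[u [v [k [Mu Mv e']]]].
    apply: (fM (m + k)%N).
    suff -> : - (f ^+ (m + k)) ^+ 2 = (f ^+ m) ^+ 2 * u + (f ^+ k) ^+ 2 * s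
        + s * u + - (a * b) * (t * v).
      apply: (MD); last by apply: (MX) => //; apply: MX.
      apply: (MD); last exact: MX.
      by apply: (MD); apply: (MX _ _ (MS _)).
    have -> : u = - (f ^+ k) ^+ 2 - b * v by rewrite e' addrK.
    have -> : s = - (f ^+ m) ^+ 2 - a * t by rewrite e addrK.
    by rewrite exprD; ring.
  move=> a b Mab Mnab; apply: contrapT => /not_orP[/not_andP[na|na] /not_andP[nb|nb]].
  + exact: no_neg na nb.
  + by apply: no_neg na nb; rewrite mulrN opprK.
  + by apply: no_neg na nb; rewrite mulNr opprK.
  + by apply: no_neg na nb; rewrite mulrNN.
Qed.

(** * The residue field of a prime cone *)

Section ResidueField.
Variables (B : comNzRingType) (M : set B) (cM : prime_cone M).

Let MD a b : M a -> M b -> M (a + b). Proof. by case: cM => -[+ _ _] _ _ _; apply. Qed.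
Let MX a b : M a -> M b -> M (a * b). Proof. by case: cM => -[_ + _] _ _ _; apply. Qed.
Let M2 a : M (a ^+ 2). Proof. by case: cM => -[_ _ +] _ _ _; apply. Qed.
Let M0 : M 0. Proof. by have := M2 0; rewrite expr0n. Qed.
Let MT a : M a \/ M (- a). Proof. exact: pcone_total. Qed.

(** The cone hypothesis is an argument so that the prime ideal structure can be attached to this
    function. *)
Definition pcone_support of prime_cone M : B -> bool := fun a => `[< M a /\ M (- a) >].

Lemma pcone_supportP a : reflect (M a /\ M (- a)) (pcone_support cM a).
Proof. exact: asboolP. Qed.

Lemma pcone_support_idealr : idealr_closed (pcone_support cM).
Proof.
split.
- by apply/pcone_supportP; rewrite oppr0.
- by apply/negP => /pcone_supportP[_]; exact: pcone_proper.
move=> a u v /pcone_supportP[Mu Mnu] /pcone_supportP[Mv Mnv].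
have [Ma|Mna] := MT a; apply/pcone_supportP; split.
- exact: MD (MX _ _) _.
- by rewrite opprD -mulrN; exact: MD (MX _ _) _.
- by rewrite -mulrNN; exact: MD (MX _ _) _.
- by rewrite opprD -mulNr; exact: MD (MX _ _) _.
Qed.

Lemma pcone_support_prime : prime_idealr_closed (pcone_support cM).
Proof.
move=> a b /pcone_supportP[Mab Mnab].
by have [?|?] := pcone_prime cM Mab Mnab; apply/orP; [left|right]; apply/pcone_supportP.
Qed.

HB.instance Definition _ := isIdealr.Build B (pcone_support cM) pcone_support_idealr.
HB.instance Definition _ :=
  isPrimeIdealrClosed.Build B (pcone_support cM) pcone_support_prime.

Definition pcone_ideal : prime_idealr B := PrimeIdealr.clone B (pcone_support cM) _.

Definition residue := {ideal_quot pcone_ideal}.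
HB.instance Definition _ := GRing.ComNzRing.on residue.

(** The fraction field is formed over an integral domain equipped with units and inverses; here
    these come from classical choice, with the identity as inverse outside the units. *)
Definition residue_unit (x : residue) : bool := `[< exists y, y * x = 1 >].

Definition residue_inv (x : residue) : residue :=
  if pselect (exists y, y * x = 1) is left xV then projT1 (cid xV) else x.

Lemma residue_mulVr : {in residue_unit, left_inverse 1 residue_inv *%R}.
Proof.
move=> x /asboolP xV; rewrite /residue_inv; case: pselect => // xV'.
by case: cid.
Qed.

Lemma residue_unitP x y : y * x = 1 -> residue_unit x.
Proof. by move=> xy; apply/asboolP; exists y. Qed.

Lemma residue_invr_out : {in [predC residue_unit], residue_inv =1 id}.
Proof. by move=> x /asboolP nx; rewrite /residue_inv; case: pselect. Qed.

HB.instance Definition _ := GRing.ComNzRing_hasMulInverse.Build residue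
  residue_mulVr residue_unitP residue_invr_out.

HB.instance Definition _ := GRing.ComUnitRing_isIntegral.Build residue
  (@Quotient.rquot_IdomainAxiom B pcone_ideal).

Definition residue_proj (a : B) : residue := \pi_({ideal_quot pcone_ideal})%qT a.
HB.instance Definition _ := GRing.RMorphism.copy residue_proj
  (\pi_({ideal_quot pcone_ideal})%qT : B -> residue).

Definition residue_field := {fraction residue}.
HB.instance Definition _ := GRing.Field.on residue_field.


Definition residue_embed (a : B) : residue_field := FracField.tofrac (residue_proj a).
HB.instance Definition _ := GRing.RMorphism.copy residue_embed
  (@FracField.tofrac residue \o residue_proj).

Lemma residue_embed_eq0 a : residue_embed a = 0 <-> M a /\ M (- a).
Proof.
rewrite /residue_embed; split => [/eqP|sa].
  rewrite tofrac_eq0 -(rmorph0 residue_proj) -Quotient.idealrBE subr0.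
  by move/pcone_supportP.
apply/eqP; rewrite tofrac_eq0 -(rmorph0 residue_proj) -Quotient.idealrBE subr0.
exact/pcone_supportP.
Qed.

Lemma residue_fieldP (z : residue_field) :
  exists a b, residue_embed b != 0 /\ z = residue_embed a / residue_embed b.
Proof.
have [n [d [d0 ->]]] := fraction_ratioP z; exists (repr n), (repr d).
by rewrite /residue_embed /residue_proj !reprK tofrac_eq0.
Qed.

End ResidueField.

(** * The ordering induced by a prime cone on fractions *)

Section OrderedFractions.
Variables (B : comNzRingType) (M : set B) (cM : prime_cone M).
Variables (F : fieldType) (phi : {rmorphism B -> F}).
Hypothesis phi_eq0 : forall a, phi a = 0 <-> M a /\ M (- a).
Hypothesis phi_frac : forall z, exists a b, phi b != 0 /\ z = phi a / phi b.

Let MD a b : M a -> M b -> M (a + b). Proof. by case: cM => -[+ _ _] _ _ _; apply. Qed.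
Let MX a b : M a -> M b -> M (a * b). Proof. by case: cM => -[_ + _] _ _ _; apply. Qed.
Let M2 a : M (a ^+ 2). Proof. by case: cM => -[_ _ +] _ _ _; apply. Qed.
Let MT a : M a \/ M (- a). Proof. exact: pcone_total. Qed.

(** Since a / b = a b / b^2, the sign of the fraction is that of a b. *)
Definition fraction_nonneg (z : F) : bool :=
  `[< exists a b, [/\ phi b != 0, M (a * b) & z = phi a / phi b] >].

Local Notation nonneg := fraction_nonneg.

Lemma fraction_nonneg_embed a : M a -> nonneg (phi a).
Proof.
by move=> Ma; apply/asboolP; exists a, 1; rewrite rmorph1 oner_neq0 mulr1 divr1.
Qed.

Lemma fraction_nonnegD x y : nonneg x -> nonneg y -> nonneg (x + y).
Proof.
move=> /asboolP[a [b [b0 Mab ->]]] /asboolP[c [d [d0 Mcd ->]]]; apply/asboolP.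
exists (a * d + c * b), (b * d); rewrite rmorphM mulf_neq0//; split=> //.
  rewrite (_ : _ * _ = a * b * d ^+ 2 + c * d * b ^+ 2); last by ring.
  exact: MD (MX Mab (M2 d)) (MX Mcd (M2 b)).
by rewrite rmorphD !rmorphM; field; rewrite ?b0 ?d0.
Qed.

Lemma fraction_nonnegM x y : nonneg x -> nonneg y -> nonneg (x * y).
Proof.
move=> /asboolP[a [b [b0 Mab ->]]] /asboolP[c [d [d0 Mcd ->]]]; apply/asboolP.
exists (a * c), (b * d); rewrite !rmorphM mulf_neq0//; split=> //.
  by rewrite mulrACA; exact: MX.
by field; rewrite ?b0 ?d0.
Qed.

Lemma fraction_nonneg_anti x : nonneg x -> nonneg (- x) -> x = 0.
Proof.
move=> /asboolP[a [b [b0 Mab ->]]] /asboolP[c [d [d0 Mcd e]]].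
have e' : phi (a * d + c * b) = 0.
  rewrite rmorphD !rmorphM; apply: (mulIf (invr_neq0 b0)); apply: (mulIf (invr_neq0 d0)).
  by rewrite !mul0r -(subrr (phi a / phi b)) e; field; rewrite ?b0 ?d0.
have [_ Mn] : M ((a * d + c * b) * (b * d)) /\ M (- ((a * d + c * b) * (b * d))).
  by apply/phi_eq0; rewrite rmorphM e' mul0r.
(* As a / b = - c / d, the element (a d + c b) b d is in the support; adding c d b^2 to its opposite
   shows that - a b d^2 is in M. *)
have : phi (a * b * d ^+ 2) = 0.
  apply/phi_eq0; split; first exact: MX.
  rewrite (_ : - _ = - ((a * d + c * b) * (b * d)) + c * d * b ^+ 2); last by ring.
  by apply: MD => //; exact: MX.
rewrite !rmorphM => /eqP; rewrite !mulf_eq0 (negPf b0) (negPf d0) !orbF => /eqP ->.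
by rewrite mul0r.
Qed.

Lemma fraction_nonneg_total x : nonneg x || nonneg (- x).
Proof.
have [a [b [b0 ->]]] := phi_frac x; apply/orP.
have [Mab|Mab] := MT (a * b); [left|right]; apply/asboolP.
  by exists a, b.
by exists (- a), b; rewrite mulNr rmorphN mulNr.
Qed.

Definition fraction_le x y := nonneg (y - x).
Definition fraction_norm x := if nonneg x then x else - x.

Fact fraction_le0D x y : fraction_le 0 x -> fraction_le 0 y -> fraction_le 0 (x + y).
Proof. by rewrite /fraction_le !subr0; exact: fraction_nonnegD. Qed.

Fact fraction_le0M x y : fraction_le 0 x -> fraction_le 0 y -> fraction_le 0 (x * y).
Proof. by rewrite /fraction_le !subr0; exact: fraction_nonnegM. Qed.

Fact fraction_le0_anti x : fraction_le 0 x -> fraction_le x 0 -> x = 0.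
Proof. by rewrite /fraction_le subr0 sub0r; exact: fraction_nonneg_anti. Qed.

Fact fraction_sub_ge0 x y : fraction_le 0 (y - x) = fraction_le x y.
Proof. by rewrite /fraction_le subr0. Qed.

Fact fraction_le0_total x : fraction_le 0 x || fraction_le x 0.
Proof. by rewrite /fraction_le subr0 sub0r; exact: fraction_nonneg_total. Qed.

Fact fraction_normN x : fraction_norm (- x) = fraction_norm x.
Proof.
rewrite /fraction_norm opprK; case: ifPn => nx; case: ifPn => nx' //.
  by rewrite (fraction_nonneg_anti nx' nx) oppr0.
by have := fraction_nonneg_total x; rewrite (negPf nx) (negPf nx').
Qed.

Fact fraction_ge0_norm x : fraction_le 0 x -> fraction_norm x = x.
Proof. by rewrite /fraction_le subr0 /fraction_norm => ->. Qed.

(** An alias of F indexed by the hypotheses, on which the order attached to it depends. *)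
Definition ordered_fractions of prime_cone M & (forall a, phi a = 0 <-> M a /\ M (- a))
  & (forall z, exists a b, phi b != 0 /\ z = phi a / phi b) : Type := F.
Local Notation K := (ordered_fractions cM phi_eq0 phi_frac).
HB.instance Definition _ := GRing.Field.on K.
HB.instance Definition _ := Num.IntegralDomain_isLeReal.Build K
  fraction_le0D fraction_le0M fraction_le0_anti fraction_sub_ge0 fraction_le0_total
  fraction_normN fraction_ge0_norm (fun _ _ => erefl).

Lemma pcone_ge0 a : M a -> 0 <= (phi a : K).
Proof. by move=> Ma; rewrite /Order.le/= /fraction_le subr0; exact: fraction_nonneg_embed. Qed.

End OrderedFractions.

(** The abstract core of the Positivstellensatz. In its uses T contains an ideal, which [phi] then
    kills, being nonnegative on g and on - g. *)
Lemma exists_ordered_field (B : comNzRingType) (T : set B) (f : B) :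
  preordering T -> avoids_powers f T ->
  exists (L : realFieldType) (phi : {rmorphism B -> L}),
    (forall t, T t -> 0 <= phi t) /\ phi f != 0.
Proof.
move=> TT fT; have [M [TM cM Mf]] := exists_prime_cone TT fT.
pose K := ordered_fractions cM (residue_embed_eq0 cM) (@residue_fieldP B M cM).
exists K, (residue_embed cM); split.
  by move=> t /TM; exact: pcone_ge0.
by apply/eqP => /residue_embed_eq0.
Qed.

(** * Adjoining roots at sign changes *)

(** Two sets of weights occur: the nonnegative constants of an ordered field, and {1}, which gives
    plain sums of squares. *)
Inductive weighted_sos (B : comNzRingType) (N : set B) : B -> Prop :=
| WSos0 : weighted_sos N 0
| WSosD c g s : N c -> weighted_sos N s -> weighted_sos N (c * g ^+ 2 + s).

Section WeightedSos.
Variables (B : comNzRingType) (N : set B).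
Implicit Types s t : B.

Lemma weighted_sosD s t :
  weighted_sos N s -> weighted_sos N t -> weighted_sos N (s + t).
Proof.
move=> + tS; elim=> [|c g s' Nc _ IH]; first by rewrite add0r.
by rewrite -addrA; exact: WSosD.
Qed.

Lemma weighted_sosM s t : (forall c d, N c -> N d -> N (c * d)) ->
  weighted_sos N s -> weighted_sos N t -> weighted_sos N (s * t).
Proof.
move=> NM + tS; elim=> [|c g s' Nc _ IH]; first by rewrite mul0r; exact: WSos0.
rewrite mulrDl; apply: weighted_sosD => //.
elim: tS => [|d k t' Nd _ IH']; first by rewrite mulr0; exact: WSos0.
by rewrite mulrDr mulrACA -exprMn; apply: WSosD => //; exact: NM.
Qed.

Lemma weighted_sos_sqr c g : N c -> weighted_sos N (c * g ^+ 2).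
Proof. by move=> Nc; rewrite -[_ * _]addr0; apply: WSosD => //; exact: WSos0. Qed.

End WeightedSos.

Section NonnegWeights.
Variable F : realFieldType.
Implicit Types (s g h k p : {poly F}).

Definition nonneg_const : set {poly F} := [set c%:P | c in [set c : F | 0 <= c]].

Lemma nonneg_constM c d : nonneg_const c -> nonneg_const d -> nonneg_const (c * d).
Proof.
by move=> [a a0 <-] [b b0 <-]; exists (a * b); rewrite /= ?polyCM// mulr_ge0.
Qed.

Lemma nonneg_const1 : nonneg_const 1.
Proof. by exists 1 => //=; exact: ler01. Qed.

Local Notation weighted_sos := (weighted_sos nonneg_const).

Lemma weighted_sos_ge0 s x : weighted_sos s -> 0 <= s.[x].
Proof.
elim=> [|_ g s' [c c0 <-] _ IH]; first by rewrite horner0.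
by rewrite hornerD hornerM hornerC horner_exp addr_ge0// mulr_ge0// sqr_ge0.
Qed.

(** Each g is replaced by its remainder modulo h, of size at most size h - 1; the constant weights
    do not raise the degree of the squares. *)
Lemma weighted_sos_mod s h : h != 0 -> weighted_sos s ->
  exists s', [/\ weighted_sos s', h %| s - s' & (size s' <= (size h).-1.*2.-1)%N].
Proof.
move=> h0; elim=> [|_ g s1 [c c0 <-] _ [s' [s'S hs' szs']]].
  by exists 0; split; rewrite ?subrr ?dvdp0 ?size_poly0//; exact: WSos0.
exists (c%:P * (g %% h) ^+ 2 + s'); split.
- by apply: WSosD => //; exists c.
- rewrite [X in h %| X](_ : _ = c%:P * (g ^+ 2 - (g %% h) ^+ 2) + (s1 - s')); last by ring.
  rewrite dvdp_add// subr_sqr; apply: dvdp_mull; apply: dvdp_mulr.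
  by rewrite {1}(divp_eq g h) addrK dvdp_mull.
- have szg : (size (g %% h)%R <= (size h).-1)%N.
    by rewrite -ltnS (leq_trans (ltn_modpN0 _ h0))// leqSpred.
  apply: leq_trans (size_polyD _ _) _; rewrite geq_max szs' andbT mul_polyC.
  apply: leq_trans (size_scale_leq _ _) _; rewrite expr2.
  apply: leq_trans (size_polyMleq _ _) _.
  by rewrite -subn1 -[leqRHS]subn1 leq_sub2r// -addnn leq_add.
Qed.

(* After reducing the squares in s modulo h, the cofactor k has smaller degree than h, and it
   changes sign between a and b as h does. *)
Lemma sign_change_not_sos h a b k s :
  h.[a] * h.[b] < 0 -> weighted_sos s -> 1 + s = k * h -> False.
Proof.
have [n] := ubnP (size h); elim: n => // n IH in h k s *; rewrite ltnS => szh hab sS e.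
have h0 : h != 0 by apply/eqP => h0; rewrite h0 !horner0 mul0r ltxx in hab.
have szh1 : (1 < size h)%N.
  rewrite ltnNge; apply/negP => /size1_polyC hC; move: hab.
  by rewrite hC !hornerC -expr2 ltNge sqr_ge0.
have [s' [s'S hs' szs']] := weighted_sos_mod h0 sS.
have /divpK e' : h %| 1 + s'.
  rewrite [1 + s'](_ : _ = k * h - (s - s')); last by rewrite -e; ring.
  by rewrite dvdp_sub// dvdp_mull.
set k' := (1 + s') %/ h in e'.
have pos x : 0 < k'.[x] * h.[x].
  by rewrite -hornerM e' hornerD hornerE ltr_pwDl//; exact: weighted_sos_ge0.
apply: (IH k' h s') => //; last by rewrite mulrC.
  have : (size (k' * h)%R <= (size h).-1.*2.-1)%N.
    rewrite e' (leq_trans (size_polyD _ _))// size_poly1 geq_max szs' andbT.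
    by case: (size h) szh1 => [|[|m]].
  have k0 : k' != 0 by apply/eqP => k0; have := pos a; rewrite k0 horner0 mul0r ltxx.
  rewrite size_mul//; have := size_poly_gt0 k'; rewrite k0.
  move: szh szh1; move: (size h) (size k') => i j; lia.
have := mulr_gt0 (pos a) (pos b); rewrite mulrACA => p.
by rewrite (nmulr_lgt0 _ hab) in p.
Qed.

End NonnegWeights.

Definition nonneg_morph (F F' : realFieldType) (iota : {rmorphism F -> F'}) : Prop :=
  forall x, 0 <= x -> 0 <= iota x.

Lemma rmorph_poly_horner (A : comNzRingType) (C : comNzRingType)
    (phi : {rmorphism {poly A} -> C}) (p : {poly A}) :
  (map_poly (phi \o polyC) p).[phi 'X] = phi p.
Proof. by rewrite map_poly_comp horner_map/= -/(p \Po 'X) comp_polyXr. Qed.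

(** The sums of squares weighted by nonnegative constants, taken modulo h, form a preordering
    without - 1 by [sign_change_not_sos]. In the resulting ordered field the image of ['X] is a root
    of h. *)
Lemma adjoin_sign_change_root (F : realFieldType) (h : {poly F}) a b :
  h.[a] * h.[b] < 0 ->
  exists (F' : realFieldType) (iota : {rmorphism F -> F'}) (c : F'),
    nonneg_morph iota /\ root (map_poly iota h) c.
Proof.
move=> hab; pose T : set {poly F} :=
  [set t | exists s k, weighted_sos (@nonneg_const F) s /\ t = s + k * h].
have TT : preordering T.
  split.
  - move=> _ _ [s [k [sS ->]]] [s' [k' [sS' ->]]].
    by exists (s + s'), (k + k'); split; [exact: weighted_sosD|ring].
  - move=> _ _ [s [k [sS ->]]] [s' [k' [sS' ->]]].
    exists (s * s'), (k * s' + s * k' + k * k' * h).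
    by split; [exact: weighted_sosM (@nonneg_constM F) _ _|ring].
  - move=> g; exists (g ^+ 2), 0; split; last by ring.
    by rewrite -[_ ^+ 2]mul1r; exact: weighted_sos_sqr (nonneg_const1 F).
(* With f = 1, every instance of [avoids_powers] says that - 1 is not in T. *)
have T1 : avoids_powers 1 T.
  move=> m [s [k [sS e]]]; apply: (sign_change_not_sos hab sS (k := - k)).
  by rewrite !expr1n in e; rewrite mulNr -[in LHS](opprK 1) e; ring.
have [L [phi [phiT _]]] := exists_ordered_field TT T1.
exists L, (phi \o polyC), (phi 'X); split.
  move=> c c0 /=; apply: phiT; exists c%:P, 0; split; last by ring.
  by rewrite -[_%:P]mulr1 -(expr1n _ 2); apply: weighted_sos_sqr; exists c.
rewrite /root rmorph_poly_horner eq_le -oppr_ge0 -rmorphN.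
by apply/andP; split; apply: phiT; [exists 0, (- 1)|exists 0, 1];
  split; [exact: WSos0|ring|exact: WSos0|ring].
Qed.

Definition ivt_poly (F : realFieldType) (p : {poly F}) : Prop :=
  forall a b, a < b -> p.[a] * p.[b] < 0 -> exists c, a < c < b /\ root p c.

(** A root r of h lies outside ]a, b[, so (a - r)(b - r) > 0 and dividing by X - r preserves the
    sign change. A root of g in an extension is therefore new. *)
Lemma rootless_sign_change_divisor (F : realFieldType) (h : {poly F}) a b :
  a < b -> h.[a] * h.[b] < 0 -> (forall c, a < c < b -> ~~ root h c) ->
  exists g, [/\ g %| h, g.[a] * g.[b] < 0 & forall c, ~~ root g c].
Proof.
move=> ab; have [n] := ubnP (size h); elim: n => // n IH in h *.
rewrite ltnS => szh hab hN.
have h0 : h != 0 by apply/eqP => h0; rewrite h0 !horner0 mul0r ltxx in hab.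
have [[r hr]|nr] := pselect (exists r, root h r); last first.
  by exists h; split=> // c; apply/negP => hc; apply: nr; exists c.
have [q e] := factor_theorem _ _ hr.
have qh : q %| h by rewrite e dvdp_mulIl.
have q0 : q != 0 by apply: contraNneq h0; rewrite e => ->; rewrite mul0r.
have rab : 0 < (a - r) * (b - r).
  have ar : a != r.
    by apply: contraTneq hab => ->; rewrite (rootP hr) mul0r ltxx.
  have br : b != r.
    by apply: contraTneq hab => ->; rewrite (rootP hr) mulr0 ltxx.
  have := contraL (hN r) hr; rewrite negb_and -!leNgt => /orP[ra|br'].
    have ra' : r < a by rewrite lt_neqAle eq_sym ar.
    by rewrite mulr_gt0// subr_gt0// (lt_trans ra').
  have br'' : b < r by rewrite lt_neqAle br.
  by rewrite nmulr_rgt0 subr_lt0// (lt_trans ab).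
have [] := IH q.
- by rewrite (leq_trans _ szh)// e size_Mmonic ?monicXsubC// size_XsubC addnC.
- by move: hab; rewrite e !hornerM !hornerXsubC mulrACA pmulr_llt0.
- by move=> c /hN; apply: contraNN; exact: root_dvdp.
by move=> g [gq gab gN]; exists g; split=> //; exact: dvdp_trans gq qh.
Qed.

(* Each failure of the intermediate value property provides a new root of G in some
   extension, and G has boundedly many roots. *)
Lemma ivt_extension_bound m (F : realFieldType) (G : {poly F}) (rs : seq F) :
  G != 0 -> uniq rs -> all (root G) rs -> (size G <= size rs + m)%N ->
  exists (F' : realFieldType) (iota : {rmorphism F -> F'}),
    nonneg_morph iota /\ forall h, h %| map_poly iota G -> ivt_poly h.
Proof.
elim: m => [|m IH] in F G rs *.
  by move=> G0 Urs Grs; rewrite addn0 leqNgt max_poly_roots.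
move=> G0 Urs Grs szG.
have [ivtG|] := pselect (forall h, h %| G -> ivt_poly h).
  by exists F, idfun; split=> [x //|h]; rewrite map_poly_id//; exact: ivtG.
move=> /existsNP[h /not_implyP[hG]] /existsNP[a /existsNP[b /not_implyP[ab]]].
move=> /not_implyP[hab hN].
have [] := @rootless_sign_change_divisor _ h a b ab hab.
  by move=> c cab; apply/negP => hc; apply: hN; exists c.
move=> g [gh gab gN]; have [F1 [i1 [c [i1_ge0 gc]]]] := adjoin_sign_change_root gab.
have [|||| F2 [i2 [i2_ge0 ivtG]]] := IH F1 (map_poly i1 G) (c :: map i1 rs).
- by rewrite map_poly_eq0.
- rewrite /= map_inj_uniq ?Urs ?andbT//; last exact: fmorph_inj.
  apply/mapP => -[r _ cr]; move: gc; rewrite cr fmorph_root; exact/negP.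
- rewrite /= (root_dvdp _ gc) ?dvdp_map ?(dvdp_trans gh hG)//=.
  by rewrite all_map; apply: sub_all Grs => r; rewrite /= fmorph_root.
- by rewrite size_map_poly /= size_map addSnnS.
exists F2, (i2 \o i1); split=> [x x0|k].
  by apply: i2_ge0; exact: i1_ge0.
by rewrite map_poly_comp; exact: ivtG.
Qed.

Lemma ivt_extension (F : realFieldType) (S : seq {poly F}) :
  exists (F' : realFieldType) (iota : {rmorphism F -> F'}),
    nonneg_morph iota /\ forall p, p \in S -> ivt_poly (map_poly iota p).
Proof.
(* Every nonzero member of S divides G, so handling the divisors of G handles them all at once. *)
pose G := \prod_(p <- S | p != 0) p.
have G0 : G != 0 by rewrite prodf_seq_neq0; apply/allP => p _; apply/implyP.
have [F' [iota [i_ge0 ivtG]]] := @ivt_extension_bound (size G) F G [::] G0 isT isT (leqnn _).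
exists F', iota; split=> // p pS; have [->|p0] := eqVneq p 0.
  by move=> a b _; rewrite rmorph0 !horner0 mul0r ltxx.
apply: ivtG; rewrite dvdp_map /G (big_rem p)//= p0; exact: dvdp_mulIl.
Qed.

(** * Signs of polynomials on an ordered line *)

Section OneField.
Variable F : realFieldType.
Implicit Types (p q : {poly F}) (a b c t x : F) (S : seq {poly F}).

(** Continuity at c over an ordered field: p - p(c) = (X - c) r, and r is bounded on
    [c - 1, c + 1]. *)
Lemma horner_pos_near p c : 0 < p.[c] ->
  exists2 e, 0 < e & forall x, c - e < x < c + e -> 0 < p.[x].
Proof.
move=> pc0; have /factor_theorem[r e] : root (p - p.[c]%:P) c.
  by rewrite rootE !hornerE subrr.
have {}e : p = r * ('X - c%:P) + p.[c]%:P by rewrite -e subrK.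
have [M rM] := poly_itv_bound r (c - 1) (c + 1).
have M0 : 0 < M + 1.
  have /rM : c - 1 <= c <= c + 1 by lra.
  by have := normr_ge0 r.[c]; lra.
exists (Num.min 1 (p.[c] / (M + 1))).
  by rewrite lt_min ltr01 divr_gt0.
move=> x; rewrite ltrBlDr -ltrBlDl addrC -ltrBlDl => /andP[x1 x2].
have : `|x - c| < Num.min 1 (p.[c] / (M + 1)) by rewrite ltr_norml; lra.
rewrite lt_min => /andP[xc1 xc2].
have rx : `|r.[x]| <= M by apply: rM; move: xc1; rewrite ltr_norml; lra.
rewrite e hornerD hornerM hornerXsubC hornerC.
have : `|r.[x] * (x - c)| < p.[c].
  rewrite normrM; apply: le_lt_trans (_ : (M + 1) * `|x - c| < _).
    by rewrite ler_wpM2r//; lra.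
  by rewrite mulrC -ltr_pdivlMr.
by rewrite ltr_norml; lra.
Qed.

(* With p = (X - c)^(k+1) q and q(c) <> 0, one has
   p p' = (X - c)^(2k+1) ((k+1) q^2 + (X - c) q q'). *)
Lemma sign_mul_deriv_near p c : p != 0 -> root p c ->
  exists2 e, 0 < e & (forall x, c - e < x < c -> p.[x] * p^`().[x] < 0) /\
                     (forall x, c < x < c + e -> 0 < p.[x] * p^`().[x]).
Proof.
move=> p0 pc; have [m [q]] := multiplicity_XsubC p c.
rewrite p0 /= => qc e; case: m => [|k] in e.
  by move: pc; rewrite e expr0 mulr1 (negPf qc).
pose s := k.+1%:R%:P * q ^+ 2 + ('X - c%:P) * (q * q^`()).
have [d d0 sd] : exists2 d, 0 < d & forall x, c - d < x < c + d -> 0 < s.[x].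
  apply: horner_pos_near.
  rewrite /s !(hornerXsubC, hornerD, hornerM, horner_exp, hornerC) subrr mul0r addr0.
  by rewrite mulr_gt0 ?ltr0Sn// lt0r sqrf_eq0 sqr_ge0 andbT.
have pp x : p.[x] * p^`().[x] = (x - c) * ((x - c) ^+ k) ^+ 2 * s.[x].
  rewrite {2}e derivM deriv_exp derivXsubC /= e.
  rewrite /s !(hornerXsubC, hornerD, hornerM, hornerMn, horner_exp, hornerC).
  by rewrite -mulr_natl exprS; ring.
have sqr_pos x : x != c -> 0 < ((x - c) ^+ k) ^+ 2.
  by move=> xc; rewrite lt0r sqrf_eq0 sqr_ge0 expf_neq0// subr_eq0.
exists d => //; split=> x /andP[x1 x2]; rewrite pp.
  have sx : 0 < s.[x] by apply: sd; lra.
  by rewrite pmulr_llt0// pmulr_llt0 ?subr_lt0// sqr_pos// lt_eqF.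
have sx : 0 < s.[x] by apply: sd; lra.
by rewrite pmulr_lgt0// pmulr_lgt0 ?subr_gt0// sqr_pos// gt_eqF.
Qed.

(** Induction on the degree: X - w is divided out, and if the quotient has a root in ]a, w[ the
    search continues from it; otherwise w is the least root. *)
Lemma least_root p a w : p != 0 -> a < w -> root p w ->
  exists c, [/\ a < c <= w, root p c & forall x, a < x < c -> ~~ root p x].
Proof.
have [n] := ubnP (size p); elim: n => // n IH in p w *.
rewrite ltnS => szp p0 aw pw.
have [q e] := factor_theorem _ _ pw.
have q0 : q != 0 by apply: contraNneq p0; rewrite e => ->; rewrite mul0r.
have [[v [av vw qv]]|nv] := pselect (exists v, [/\ a < v, v < w & root q v]).
  have [] := IH q v _ q0 av qv.
    by rewrite (leq_trans _ szp)// e size_Mmonic ?monicXsubC// size_XsubC addnC.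
  move=> c [/andP[ac cv] qc cN]; exists c; split.
  - by rewrite ac (le_trans cv)// ltW.
  - by rewrite e rootM qc.
  - move=> x xc; rewrite e rootM root_XsubC negb_or cN//=.
    by rewrite lt_eqF//; lra.
exists w; split=> //; first by rewrite aw lexx.
move=> x /andP[ax xw]; rewrite e rootM root_XsubC negb_or lt_eqF// andbT.
by apply/negP => qx; apply: nv; exists x.
Qed.

(** Near a root, p p' is negative on the left and positive on the right. So p is positive at some a1
    >= a; were p(b) <= 0, p would be negative just before its least root after a1, and the
    intermediate value property would give an earlier root. *)
Lemma deriv_pos_incr p a b : ivt_poly p -> a < b ->
  (forall x, a <= x < b -> 0 < p^`().[x]) -> 0 <= p.[a] -> 0 < p.[b].
Proof.
move=> ivtp ab p'0 pa0.
have p0 : p != 0.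
  apply/eqP => p0; have := p'0 a; rewrite lexx ab p0 deriv0 horner0 ltxx.
  by move=> /(_ isT).
have [a1 a1ab pa1] : exists2 a1, a <= a1 < b & 0 < p.[a1].
  move: pa0; rewrite le_eqVlt => /orP[/eqP/esym/eqP pa|pa]; last by exists a; rewrite // lexx.
  have [e e0 [_ pe]] := sign_mul_deriv_near p0 pa.
  pose a1 := Num.min (a + e / 2) ((a + b) / 2).
  have [l1 [l2 l3]] : a < a1 /\ a1 < a + e /\ a1 < b.
    rewrite lt_min !gt_min; split; [apply/andP; split|split; apply/orP].
    + lra.
    + lra.
    + by left; lra.
    + by right; lra.
  by exists a1; [lra|rewrite -(pmulr_lgt0 _ (p'0 a1 _)) ?pe//; lra].
rewrite ltNge; apply/negP => pb0.
have [w [aw wb pw]] : exists w, [/\ a1 < w, w <= b & root p w].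
  move: pb0; rewrite le_eqVlt => /orP[pb|pb].
    by exists b; split=> //; case/andP: a1ab.
  have [||w [/andP[a1w wb] pw]] := ivtp a1 b; first by case/andP: a1ab.
    by rewrite pmulr_rlt0.
  by exists w; split=> //; exact: ltW.
have [c [/andP[a1c cw] pc cN]] := least_root p0 aw pw.
have [e e0 [pe _]] := sign_mul_deriv_near p0 pc.
pose x := Num.max (c - e / 2) ((a1 + c) / 2).
have [l1 [l2 l3]] : a1 < x /\ c - e < x /\ x < c.
  rewrite gt_max !lt_max; split; [|split].
  - by apply/orP; right; lra.
  - by apply/orP; left; lra.
  - by apply/andP; split; lra.
have px0 : p.[x] < 0 by rewrite -(pmulr_llt0 _ (p'0 x _)) ?pe//; lra.
have [||y [y1 py]] := ivtp a1 x => //; first by rewrite pmulr_rlt0.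
by have := cN y; rewrite py => /(_ ltac:(lra)).
Qed.

End OneField.

(** * Thom's lemma *)

Section SignClasses.
Variable F : realFieldType.
Implicit Types (p q d : {poly F}) (a b c t x : F) (S : seq {poly F}).

Lemma ivt_polyN p : ivt_poly p -> ivt_poly (- p).
Proof.
move=> ivtp u v uv; rewrite !hornerN mulrNN => /(ivtp _ _ uv)[c [uc pc]].
by exists c; rewrite rootN.
Qed.

Lemma ivt_poly_sgz p a b : ivt_poly p -> a <= b ->
  (forall t, a <= t <= b -> ~~ root p t) -> sgz p.[b] = sgz p.[a].
Proof.
move=> ivtp; rewrite le_eqVlt => /orP[/eqP->//|ab] pN.
have pa : p.[a] != 0 by apply: pN; rewrite lexx ltW.
have pb : p.[b] != 0 by apply: pN; rewrite lexx ltW.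
have [pab|] := ltP (p.[a] * p.[b]) 0.
  have [t [/andP[at' tb] pt]] := ivtp a b ab pab.
  by have := pN t; rewrite pt !ltW// => /(_ isT).
rewrite le_eqVlt eq_sym mulf_eq0 (negPf pa) (negPf pb) /= -sgz_gt0 sgzM.
by case: (sgzP p.[a]); case: (sgzP p.[b]).
Qed.

Lemma root_interval_eq0 p a b : a < b -> (forall t, a <= t <= b -> root p t) -> p = 0.
Proof.
move=> ab pab; apply/eqP; apply: contraT => p0.
have [|e e0 [_ pe]] := @sign_mul_deriv_near _ p a p0; first by apply: pab; rewrite lexx ltW.
pose x := Num.min (a + e / 2) b.
have [l1 [l2 l3]] : a < x /\ x < a + e /\ x <= b.
  rewrite lt_min gt_min ge_min lexx orbT.
  by split; [apply/andP; split|split=> //; apply/orP; left]; lra.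
have := pe x; rewrite (rootP (pab x _)); last by lra.
by rewrite mul0r ltxx l1 l2 => /(_ isT).
Qed.

Lemma horner_deriv0 p x : p^`() = 0 -> p.[x] = lead_coef p.
Proof.
move=> p'0; rewrite [p]size1_polyC ?hornerC ?lead_coefC//.
apply/leq_sizeP => -[//|j] _; apply/eqP.
have /eqP := congr1 (fun q : {poly F} => q`_j) p'0.
by rewrite coef_deriv coef0 mulrn_eq0.
Qed.

Lemma deriv_pos_le_sgz p a b : ivt_poly p -> a <= b ->
  (forall t, a <= t <= b -> 0 < p^`().[t]) -> sgz p.[a] <= sgz p.[b].
Proof.
move=> ivtp; rewrite le_eqVlt => /orP[/eqP->//|ab] p'0.
have := @deriv_pos_incr _ p a b ivtp ab.
have p'0' x : a <= x < b -> 0 < p^`().[x] by move=> xab; apply: p'0; lra.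
move=> /(_ p'0').
by case: (sgzP p.[a]) => // pa; case: (sgzP p.[b]) => // pb /(_ isT).
Qed.

Lemma deriv_neg_ge_sgz p a b : ivt_poly p -> a <= b ->
  (forall t, a <= t <= b -> p^`().[t] < 0) -> sgz p.[b] <= sgz p.[a].
Proof.
move=> ivtp ab p'0; rewrite -lerN2 -!sgzN -!hornerN.
apply: deriv_pos_le_sgz => //; first exact: ivt_polyN.
by move=> t /p'0; rewrite derivN hornerN oppr_gt0.
Qed.

Definition same_signs S x y := forall p, p \in S -> sgz p.[x] = sgz p.[y].

Lemma same_signs_sym S x y : same_signs S x y -> same_signs S y x.
Proof. by move=> xy p /xy. Qed.

Lemma same_signs_trans S y x z :
  same_signs S x y -> same_signs S y z -> same_signs S x z.
Proof. by move=> xy yz p pS; rewrite xy// yz. Qed.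

Definition convex_sign_classes S := forall a b c, a <= c <= b ->
  same_signs S a b -> same_signs S a c.

(** The sign is there because reflecting the line, or passing to - p, turns a derivative into the
    opposite of one. *)
Definition signed_deriv (e : bool) p d := p^`() = (-1) ^+ e *: d.

(** Up to sign p' is a member of S, and sign classes are convex, so p' has constant sign on
    [a, b]. *)
Lemma convex_sign_monotone S p d e a b : convex_sign_classes S -> d \in S ->
  signed_deriv e p d -> ivt_poly p -> a <= b -> same_signs S a b ->
  [\/ p^`() = 0 \/ a = b,
      0 < p^`().[a] /\ (forall t u, a <= t <= u -> u <= b -> sgz p.[t] <= sgz p.[u]) |
      p^`().[a] < 0 /\ (forall t u, a <= t <= u -> u <= b -> sgz p.[u] <= sgz p.[t])].
Proof.
move=> cS dS pd ivtp ab Sab.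
have sd t : a <= t <= b -> sgz p^`().[t] = sgz p^`().[a].
  by move=> /cS /(_ Sab) /(_ d dS) dt; rewrite pd !hornerZ !sgzM dt.
case: (sgzP p^`().[a]) => p'a.
- apply: Or31; move: ab; rewrite le_eqVlt => /orP[/eqP|ab]; [by right|left].
  apply: (root_interval_eq0 ab) => t /sd; rewrite p'a sgz0 => /eqP.
  by rewrite sgz_eq0.
- apply: Or32; split=> // t u /andP[at' tu] ub; apply: deriv_pos_le_sgz => // v /andP[tv vu].
  by rewrite -sgz_gt0 sd ?gtr0_sgz//; lra.
- apply: Or33; split=> // t u /andP[at' tu] ub; apply: deriv_neg_ge_sgz => // v /andP[tv vu].
  by rewrite -sgz_lt0 sd ?ltr0_sgz//; lra.
Qed.

(** The inductive step of Thom's lemma: on [a, b] the sign of p is monotone, and it agrees at both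
    ends. *)
Lemma convex_sign_classes_cons S p d e : convex_sign_classes S -> d \in S ->
  signed_deriv e p d -> ivt_poly p -> convex_sign_classes (p :: S).
Proof.
move=> cS dS pd ivtp a b c acb Sab.
have Sab' : same_signs S a b by move=> q qS; apply: Sab; rewrite inE qS orbT.
have pab : sgz p.[a] = sgz p.[b] by apply: Sab; rewrite inE eqxx.
move=> q; rewrite inE => /predU1P[->{q}|qS]; last exact: cS acb _ _ qS.
have /andP[ac cb] := acb.
have [[p'0|ab]|[_ mono]|[_ mono]] := convex_sign_monotone cS dS pd ivtp (le_trans ac cb) Sab'.
- by rewrite !horner_deriv0.
- by rewrite ab in acb *; congr (sgz p.[_]); apply/le_anti.
- by apply/le_anti; rewrite {2}pab !mono ?lexx ?ac.
- by apply/le_anti; rewrite {1}pab !mono ?lexx ?ac.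
Qed.

End SignClasses.

(** * Matching sign vectors over two ordered fields *)

(* A family is a list of pairs (p.1, p.2), to be thought of as the images of one polynomial
   over a common base ring; sign_match says that the sign vectors realized on the two lines
   are the same and appear in the same order. *)
Definition matched (F1 F2 : realFieldType) (E : seq ({poly F1} * {poly F2})) x y :=
  forall p, p \in E -> sgz p.1.[x] = sgz p.2.[y].

Record sign_match (F1 F2 : realFieldType) (E : seq ({poly F1} * {poly F2})) : Prop :=
  SignMatch {
    sm_eq0 : forall p, p \in E -> (p.1 == 0) = (p.2 == 0);
    sm_ivt1 : forall p, p \in E -> ivt_poly p.1;
    sm_ivt2 : forall p, p \in E -> ivt_poly p.2;
    sm_convex1 : convex_sign_classes (unzip1 E);
    sm_convex2 : convex_sign_classes (unzip2 E);
    sm_left : forall x, exists y, matched E x y;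
    sm_right : forall y, exists x, matched E x y;
    sm_order : forall x x' y y', x < x' -> matched E x y -> matched E x' y' ->
      ~ same_signs (unzip1 E) x x' -> y < y' }.

(** Enough to determine how p fits among the sign vectors: [em_deriv] makes p monotone between roots
    of the family, [em_root] fixes its signs at these roots, and [em_size] with [em_lead] its signs
    at both infinities. *)
Record extends_match (F1 F2 : realFieldType) (E : seq ({poly F1} * {poly F2}))
    (p : {poly F1} * {poly F2}) : Prop := ExtendsMatch {
    em_size : size p.1 = size p.2;
    em_lead : sgz (lead_coef p.1) = sgz (lead_coef p.2);
    em_ivt1 : ivt_poly p.1;
    em_ivt2 : ivt_poly p.2;
    em_deriv : exists d e, [/\ d \in E, signed_deriv e p.1 d.1 & signed_deriv e p.2 d.2];
    em_root : forall q x y, q \in E -> q.1 != 0 -> root q.1 x -> matched E x y ->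
      sgz p.1.[x] = sgz p.2.[y] }.

Section Matched.
Variables (F1 F2 : realFieldType) (E : seq ({poly F1} * {poly F2})).
Implicit Types (p q d : {poly F1} * {poly F2}).

Lemma matched_same1 x x' y : matched E x y ->
  same_signs (unzip1 E) x x' <-> matched E x' y.
Proof.
move=> xy; split=> [xx' q qE|x'y q1 /mapP[q qE ->]].
  by rewrite -xx' ?xy//; apply/mapP; exists q.
by rewrite xy// x'y.
Qed.

Lemma matched_same2 x y y' : matched E x y ->
  same_signs (unzip2 E) y y' <-> matched E x y'.
Proof.
move=> xy; split=> [yy' q qE|xy' q2 /mapP[q qE ->]].
  by rewrite -yy' ?xy//; apply/mapP; exists q.
by rewrite -xy// xy'.
Qed.

Lemma matched_same x x' y y' : matched E x y -> matched E x' y' ->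
  same_signs (unzip1 E) x x' <-> same_signs (unzip2 E) y y'.
Proof.
move=> xy x'y'; split=> [xx'|yy'].
  by apply/(matched_same2 y' xy) => q qE; rewrite xx' ?x'y'//; apply/mapP; exists q.
apply/(matched_same1 x' xy) => q qE; rewrite x'y'// yy'//.
by apply/mapP; exists q.
Qed.

Definition family_root1 x := exists2 q, q \in E & q.1 != 0 /\ root q.1 x.
Definition family_root2 y := exists2 q, q \in E & q.2 != 0 /\ root q.2 y.

Hypothesis EM : sign_match E.

Lemma matched_root p x y : p \in E -> matched E x y -> root p.1 x = root p.2 y.
Proof.
by move=> pE /(_ _ pE) pxy; rewrite !rootE -sgz_eq0 pxy sgz_eq0.
Qed.

Lemma matched_family_root x y : matched E x y -> family_root1 x <-> family_root2 y.
Proof.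
by move=> xy; split=> -[q qE [q0 qx]]; exists q => //;
  [rewrite -(sm_eq0 EM)// -(matched_root qE xy)|rewrite (sm_eq0 EM)// (matched_root qE xy)].
Qed.

Lemma family_root_not_same x x' : family_root1 x -> ~ family_root1 x' ->
  ~ same_signs (unzip1 E) x x'.
Proof.
move=> [q qE [q0 qx]] nx' xx'; apply: nx'; exists q => //; split=> //.
by rewrite rootE -sgz_eq0 -xx' ?sgz_eq0//; apply/mapP; exists q.
Qed.

(** A root and a non-root never have the same signs, so [sm_order] applies in both directions. *)
Lemma matched_root_lt x y t s : matched E x y -> matched E t s ->
  ~ family_root1 x -> family_root1 t -> (x < t) = (y < s).
Proof.
move=> xy ts nx tr.
have nxt : ~ same_signs (unzip1 E) t x by exact: family_root_not_same.
have nxt' : ~ same_signs (unzip1 E) x t by move=> /same_signs_sym.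
case: ltgtP => [xt|tx|xt]; last by case: nx; rewrite xt.
- by symmetry; exact: (sm_order EM xt).
- by have := sm_order EM tx ts xy nxt; case: ltgtP.
Qed.

Lemma least_family_root1 x t : x < t -> family_root1 t ->
  exists t', [/\ x < t' <= t, family_root1 t' & forall u, x < u < t' -> ~ family_root1 u].
Proof.
move=> xt [q qE [q0 qt]].
pose G := \prod_(q <- E | q.1 != 0) q.1.
have rootG u : root G u <-> family_root1 u.
  rewrite rootE horner_prod prodf_seq_eq0; split.
    by move=> /hasP[r rE /andP[r0 ru]]; exists r.
  by move=> [r rE [r0 ru]]; apply/hasP; exists r => //; rewrite r0.
have G0 : G != 0 by rewrite prodf_seq_neq0; apply/allP => r _; apply/implyP.
have [|t' [xt' Gt' Gmin]] := least_root G0 xt; first by apply/rootG; exists q.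
exists t'; split=> //; first exact/rootG.
by move=> u /Gmin; apply: contraNnot => /rootG.
Qed.

Lemma no_family_root_same1 a b : a <= b ->
  (forall t, a <= t <= b -> ~ family_root1 t) -> same_signs (unzip1 E) a b.
Proof.
move=> ab nr q1 /mapP[q qE ->]; have [->|q0] := eqVneq q.1 0; first by rewrite !horner0.
apply/esym/ivt_poly_sgz => //; first exact: (sm_ivt1 EM).
by move=> t tab; apply/negP => qt; apply: (nr t tab); exists q.
Qed.

End Matched.

(** * Symmetries: exchanging the two fields, reflecting the line, passing to - p *)

Definition swap_family (F1 F2 : realFieldType) (E : seq ({poly F1} * {poly F2})) :=
  [seq (q.2, q.1) | q <- E].

Section Swap.
Variables (F1 F2 : realFieldType) (E : seq ({poly F1} * {poly F2})).

Lemma matched_swap x y : matched (swap_family E) y x <-> matched E x y.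
Proof.
split=> xy q qE; last by move: qE => /mapP[r rE ->] /=; rewrite xy.
by rewrite (xy (q.2, q.1))//; apply/mapP; exists q.
Qed.

Lemma unzip1_swap : unzip1 (swap_family E) = unzip2 E.
Proof. by rewrite /unzip1 -map_comp. Qed.

Lemma unzip2_swap : unzip2 (swap_family E) = unzip1 E.
Proof. by rewrite /unzip2 -map_comp. Qed.

Lemma sign_match_swap : sign_match E -> sign_match (swap_family E).
Proof.
move=> EM; split.
- by move=> _ /mapP[q qE ->] /=; rewrite (sm_eq0 EM).
- by move=> _ /mapP[q qE ->]; exact: (sm_ivt2 EM).
- by move=> _ /mapP[q qE ->]; exact: (sm_ivt1 EM).
- by rewrite unzip1_swap; exact: sm_convex2.
- by rewrite unzip2_swap; exact: sm_convex1.
- by move=> y; have [x xy] := sm_right EM y; exists x; apply/matched_swap.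
- by move=> x; have [y xy] := sm_left EM x; exists y; apply/matched_swap.
- rewrite unzip1_swap => y y' x x' yy' /matched_swap xy /matched_swap x'y' nyy'.
  case: (ltgtP x x') => // [x'x|xx'].
    have /(sm_order EM x'x x'y' xy) : ~ same_signs (unzip1 E) x' x.
      by move=> /(matched_same x'y' xy)/same_signs_sym.
    by case: ltgtP yy'.
  by case: nyy'; apply/(matched_same xy x'y'); rewrite xx'.
Qed.

Lemma extends_match_swap p : sign_match E -> extends_match E p ->
  extends_match (swap_family E) (p.2, p.1).
Proof.
move=> EM [? ? ? ? [d [e [dE pd1 pd2]]] pr]; split=> //=.
  by exists (d.2, d.1), e; split=> //; apply/mapP; exists d.
move=> _ y x /mapP[q qE ->] /= q0 qy /matched_swap xy; apply/esym.
by apply: (pr q) => //; [rewrite (sm_eq0 EM)|rewrite (matched_root qE xy)].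
Qed.

End Swap.

Definition reflect_poly (F : realFieldType) (p : {poly F}) := p \Po - 'X.

Section Reflect.
Variable F : realFieldType.
Implicit Types p : {poly F}.

Lemma horner_reflect p x : (reflect_poly p).[x] = p.[- x].
Proof. by rewrite horner_comp hornerN hornerX. Qed.

Lemma reflect_polyK : involutive (@reflect_poly F).
Proof.
move=> p; rewrite /reflect_poly -comp_polyA raddfN /= comp_polyX.
by rewrite opprK comp_polyXr.
Qed.

Lemma reflect_poly_eq0 p : (reflect_poly p == 0) = (p == 0).
Proof.
apply/eqP/eqP => [p0|->]; last exact: comp_poly0.
by rewrite -(reflect_polyK p) p0; exact: comp_poly0.
Qed.

Lemma root_reflect p x : root (reflect_poly p) x = root p (- x).
Proof. by rewrite !rootE horner_reflect. Qed.

Lemma size_reflect p : size (reflect_poly p) = size p.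
Proof. by rewrite size_comp_poly2// size_polyN size_polyX. Qed.

Lemma lead_coef_reflect p : lead_coef (reflect_poly p) = lead_coef p * (-1) ^+ (size p).-1.
Proof. by rewrite lead_coef_comp ?size_polyN ?size_polyX// lead_coefN lead_coefX. Qed.

Lemma ivt_reflect p : ivt_poly p -> ivt_poly (reflect_poly p).
Proof.
move=> ivtp a b ab; rewrite !horner_reflect mulrC => pab.
have [|c [cab pc]] := ivtp (- b) (- a) _ pab; first by rewrite ltrN2.
by exists (- c); split; [lra|rewrite root_reflect opprK].
Qed.

Lemma signed_deriv_reflect e p d : signed_deriv e p d ->
  signed_deriv (~~ e) (reflect_poly p) (reflect_poly d).
Proof.
rewrite /signed_deriv /reflect_poly deriv_comp derivN derivX => ->.
by rewrite comp_polyZ mulrN1 -scaleNr; case: e; rewrite /= ?expr0 ?expr1 ?opprK.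
Qed.

Lemma signed_derivN e p d : signed_deriv e p d -> signed_deriv (~~ e) (- p) d.
Proof.
rewrite /signed_deriv derivN => ->.
by rewrite -scaleNr; case: e; rewrite /= ?expr0 ?expr1 ?opprK.
Qed.

Lemma same_signs_reflect S x y :
  same_signs (map (@reflect_poly F) S) x y <-> same_signs S (- x) (- y).
Proof.
split=> xy p pS; last by move: pS => /mapP[q qS ->]; rewrite !horner_reflect xy.
by rewrite -!horner_reflect xy//; apply/mapP; exists p.
Qed.

Lemma convex_reflect S : convex_sign_classes S ->
  convex_sign_classes (map (@reflect_poly F) S).
Proof.
move=> cS a b c acb /same_signs_reflect Sab; apply/same_signs_reflect.
apply: (same_signs_trans Sab); apply: cS (same_signs_sym Sab); lra.
Qed.

End Reflect.

Definition reflect_pair (F1 F2 : realFieldType) (q : {poly F1} * {poly F2}) :=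
  (reflect_poly q.1, reflect_poly q.2).

Section ReflectFamily.
Variables (F1 F2 : realFieldType) (E : seq ({poly F1} * {poly F2})).
Local Notation E' := (map (@reflect_pair F1 F2) E).

Lemma matched_reflect x y : matched E' x y <-> matched E (- x) (- y).
Proof.
split=> xy q qE; last by move: qE => /mapP[r rE ->] /=; rewrite !horner_reflect xy.
rewrite -!horner_reflect; apply: (xy (reflect_pair q)).
by apply/mapP; exists q.
Qed.

Lemma unzip1_reflect : unzip1 E' = map (@reflect_poly F1) (unzip1 E).
Proof. by rewrite /unzip1 -!map_comp. Qed.

Lemma unzip2_reflect : unzip2 E' = map (@reflect_poly F2) (unzip2 E).
Proof. by rewrite /unzip2 -!map_comp. Qed.

Lemma sign_match_reflect : sign_match E -> sign_match E'.
Proof.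
move=> EM; split.
- by move=> _ /mapP[q qE ->] /=; rewrite !reflect_poly_eq0 (sm_eq0 EM).
- by move=> _ /mapP[q qE ->]; apply: ivt_reflect; exact: (sm_ivt1 EM).
- by move=> _ /mapP[q qE ->]; apply: ivt_reflect; exact: (sm_ivt2 EM).
- by rewrite unzip1_reflect; apply: convex_reflect; exact: sm_convex1.
- by rewrite unzip2_reflect; apply: convex_reflect; exact: sm_convex2.
- move=> x; have [y xy] := sm_left EM (- x).
  by exists (- y); apply/matched_reflect; rewrite opprK.
- move=> y; have [x xy] := sm_right EM (- y).
  by exists (- x); apply/matched_reflect; rewrite opprK.
- rewrite unzip1_reflect => x x' y y' xx' /matched_reflect xy /matched_reflect x'y'.
  move=> nxx'; rewrite -ltrN2; apply: (sm_order EM) x'y' xy _; first by rewrite ltrN2.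
  by move=> /same_signs_sym/same_signs_reflect.
Qed.

Lemma extends_match_reflect p : extends_match E p -> extends_match E' (reflect_pair p).
Proof.
move=> [ps pl p1 p2 [d [e [dE pd1 pd2]]] pr]; split=> /=.
- by rewrite !size_reflect.
- by rewrite !lead_coef_reflect !sgzM pl ps !sgzX !sgzN1.
- exact: ivt_reflect.
- exact: ivt_reflect.
- exists (reflect_pair d), (~~ e); split; [|exact: signed_deriv_reflect..].
  by apply/mapP; exists d.
- move=> _ x y /mapP[q qE ->] /=; rewrite reflect_poly_eq0 root_reflect => q0 qx.
  by move=> /matched_reflect xy; rewrite !horner_reflect; exact: (pr q).
Qed.

Lemma extends_match_opp p : extends_match E p -> extends_match E (- p.1, - p.2).
Proof.
move=> [ps pl p1 p2 [d [e [dE pd1 pd2]]] pr]; split=> /=.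
- by rewrite !size_polyN.
- by rewrite !lead_coefN !sgzN pl.
- exact: ivt_polyN.
- exact: ivt_polyN.
- by exists d, (~~ e); split=> //; exact: signed_derivN.
- by move=> q x y qE q0 qx xy; rewrite !hornerN !sgzN; congr (- _); exact: (pr q).
Qed.

End ReflectFamily.

(** * Adding one polynomial to a matched family *)

Section Extension.
Variables (F1 F2 : realFieldType) (E : seq ({poly F1} * {poly F2})).
Variable p : {poly F1} * {poly F2}.
Hypotheses (EM : sign_match E) (pM : extends_match E p).

Lemma matched_deriv x y : matched E x y -> sgz (p.1)^`().[x] = sgz (p.2)^`().[y].
Proof.
have [d [e [dE pd1 pd2]]] := em_deriv pM => xy.
by rewrite pd1 pd2 !hornerZ !sgzM !sgzX !sgzN1 (xy d).
Qed.

Lemma same_signs_deriv1 x x' : same_signs (unzip1 E) x x' ->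
  sgz (p.1)^`().[x'] = sgz (p.1)^`().[x].
Proof.
have [d [e [dE pd1 _]]] := em_deriv pM => xx'.
by rewrite pd1 !hornerZ !sgzM (xx' d.1)//; apply/mapP; exists d.
Qed.

Lemma em_eq0 : (p.1 == 0) = (p.2 == 0).
Proof. by rewrite -!size_poly_eq0 (em_size pM). Qed.

(* If some root of the family lies to the right of x, let t be the least one; p.1 increases
   from x to t, so it is positive at t, hence p.2 is positive at the point matching t and
   before it. Otherwise p.1 is positive at infinity, and so is p.2. *)
Lemma match_pos_right x y0 : matched E x y0 -> ~ family_root1 E x ->
  0 < (p.1)^`().[x] -> 0 <= p.1.[x] ->
  exists y, [/\ y0 <= y, matched E x y & 0 < p.2.[y]].
Proof.
move=> xy0 nx p'x px.
have ny0 : ~ family_root2 E y0 by move=> /(matched_family_root EM xy0).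
have p10 : p.1 != 0 by apply: contraTneq p'x => ->; rewrite deriv0 horner0 ltxx.
have incr t : x < t -> (forall u, x < u < t -> ~ family_root1 E u) -> 0 < p.1.[t].
  move=> xt nr; apply: (deriv_pos_incr (em_ivt1 pM) xt) px => u /andP[xu ut].
  rewrite -sgz_gt0 (@same_signs_deriv1 x) ?sgz_gt0//.
  apply: (no_family_root_same1 EM xu) => v /andP[]; rewrite le_eqVlt.
  by move=> /predU1P[<-//|xv] vu; apply: nr; rewrite xv (le_lt_trans vu).
have EM' := sign_match_swap EM.
have root_swap y : family_root1 (swap_family E) y <-> family_root2 E y.
  split=> [[_ /mapP[q qE ->] /= qy]|[q qE qy]]; first by exists q.
  by exists (q.2, q.1) => //; apply/mapP; exists q.
have noroot_match y : y0 <= y -> (forall u, y0 <= u <= y -> ~ family_root2 E u) ->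
    matched E x y.
  move=> y0y nr; apply/(matched_same2 _ xy0); rewrite -unzip1_swap.
  by apply: (no_family_root_same1 EM' y0y) => u /nr nu /root_swap.
have [[t [xt rt]]|nt] := pselect (exists t, x < t /\ family_root1 E t).
  have [{xt rt}t [/andP[xt _] rt tmin]] := least_family_root1 xt rt.
  have [s0 ts0] := sm_left EM t.
  have y0s0 : y0 < s0 by rewrite -(matched_root_lt EM xy0 ts0).
  have rs0 : family_root1 (swap_family E) s0.
    by apply/root_swap; apply/(matched_family_root EM ts0).
  have [s [/andP[y0s ss0] /root_swap rs smin]] := least_family_root1 y0s0 rs0.
  (* The least roots t and s correspond: the point t' matching s satisfies t <= t', and if its signs
     differed from those of t, [sm_order] would give s0 < s. *)
  have ts : matched E t s.
    have [t' t's] := sm_right EM s.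
    have rt' : family_root1 E t' by apply/(matched_family_root EM t's).
    have xt' : x < t' by rewrite (matched_root_lt EM xy0 t's).
    have : t <= t' by rewrite leNgt; apply/negP => t't; apply: (tmin t') => //; rewrite xt'.
    rewrite le_eqVlt => /predU1P[->//|tt'].
    apply/(matched_same1 _ t's); apply: contrapT => ntt'.
    suff : s0 < s by rewrite ltNge ss0.
    by apply: (sm_order EM tt' ts0 t's) => /same_signs_sym.
  have ps : 0 < p.2.[s].
    have [q qE [q0 qt]] := rt.
    by rewrite -sgz_gt0 -(em_root pM qE q0 qt ts) sgz_gt0; exact: incr.
  have [e e0 pe] := horner_pos_near ps.
  (* Just before s, p.2 is still positive, and no root of the family separates y from y0, so y
     matches x. *)
  pose y := Num.max y0 (s - e / 2).
  have [l1 [l2 l3]] : y0 <= y /\ s - e < y /\ y < s.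
    rewrite le_max lexx lt_max gt_max y0s; split=> //; split; last by lra.
    by apply/orP; right; lra.
  exists y; split=> //; last by apply: pe; lra.
  apply: noroot_match => // u /andP[]; rewrite le_eqVlt => /predU1P[<-//|y0u] uy.
  by move=> /root_swap; apply: smin; rewrite y0u (le_lt_trans uy).
have {}incr t : x < t -> 0 < p.1.[t].
  by move=> xt; apply: incr => // u /andP[xu _] ru; apply: nt; exists u.
have lc1 : 0 < lead_coef p.1.
  rewrite lt0r lead_coef_eq0 p10 leNgt; apply/negP => lc1.
  have [|n pn] := @poly_pinfty_gt_lc _ (- p.1); first by rewrite lead_coefN oppr_gt0.
  have := incr (Num.max n (x + 1)); rewrite lt_max ltrDl ltr01 orbT => /(_ isT).
  have := pn (Num.max n (x + 1)); rewrite le_max lexx => /(_ isT).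
  by rewrite hornerN lead_coefN; lra.
have lc2 : 0 < lead_coef p.2 by rewrite -sgz_gt0 -(em_lead pM) sgz_gt0.
have [n pn] := poly_pinfty_gt_lc lc2.
exists (Num.max y0 n); rewrite le_max lexx; split=> //; last first.
  by apply: lt_le_trans lc2 (pn _ _); rewrite le_max lexx orbT.
apply: noroot_match; first by rewrite le_max lexx.
move=> u /andP[]; rewrite le_eqVlt => /predU1P[<-//|y0u] _ ru.
have [t tu] := sm_right EM u; apply: nt; exists t.
have rt : family_root1 E t by apply/(matched_family_root EM tu).
by split=> //; rewrite (matched_root_lt EM xy0 tu).
Qed.

End Extension.

Section MatchPos.
Variables (F1 F2 : realFieldType) (E : seq ({poly F1} * {poly F2})).
Hypothesis EM : sign_match E.
Implicit Types p : {poly F1} * {poly F2}.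

Lemma match_pos_left p x y0 : extends_match E p -> matched E x y0 -> ~ family_root1 E x ->
  (p.1)^`().[x] < 0 -> 0 <= p.1.[x] ->
  exists y, [/\ y <= y0, matched E x y & 0 < p.2.[y]].
Proof.
move=> pM xy0 nx p'x px.
have EM' := sign_match_reflect EM; have pM' := extends_match_reflect pM.
have [||||y [y0y xy py]] := @match_pos_right _ _ _ _ EM' pM' (- x) (- y0).
- by apply/matched_reflect; rewrite !opprK.
- move=> [_ /mapP[q qE ->]] /=; rewrite reflect_poly_eq0 root_reflect opprK => qx.
  by apply: nx; exists q.
- rewrite /= /reflect_poly deriv_comp derivN derivX mulrN1 hornerN.
  by rewrite -/(reflect_poly _) horner_reflect opprK oppr_gt0.
- by rewrite horner_reflect opprK.
exists (- y); split; first by rewrite lerNl.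
  by rewrite -(opprK x); apply/matched_reflect.
by rewrite -horner_reflect.
Qed.

Lemma match_pos p x y0 : extends_match E p -> matched E x y0 -> ~ family_root1 E x ->
  (p.1)^`().[x] != 0 -> 0 < p.1.[x] -> exists2 y, matched E x y & 0 < p.2.[y].
Proof.
move=> pM xy0 nx; rewrite neq_lt => /orP[p'x|p'x] px.
  by have [y [_ ? ?]] := match_pos_left pM xy0 nx p'x (ltW px); exists y.
by have [y [_ ? ?]] := match_pos_right EM pM xy0 nx p'x (ltW px); exists y.
Qed.

(** If p' is positive at x, then p.2 is positive at a match of x on the right of y0 and negative at
    one on the left. It vanishes in between, at a point matching x by convexity. *)
Lemma match_zero p x y0 : extends_match E p -> matched E x y0 -> ~ family_root1 E x ->
  (p.1)^`().[x] != 0 -> p.1.[x] = 0 -> exists2 y, matched E x y & p.2.[y] = 0.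
Proof.
move=> pM xy0 nx p'0 px.
wlog p'x : p pM p'0 px / 0 < (p.1)^`().[x].
  move=> H; have := p'0; rewrite neq_lt => /orP[p'x|p'x]; last exact: H.
  have [|||y xy py] := H _ (extends_match_opp pM).
  - by rewrite /= derivN hornerN oppr_eq0.
  - by rewrite /= hornerN px oppr0.
  - by rewrite /= derivN hornerN oppr_gt0.
  by exists y => //; apply/eqP; rewrite -oppr_eq0 -hornerN py.
have px0 : 0 <= p.1.[x] by rewrite px.
have [y1 [y01 xy1 py1]] := match_pos_right EM pM xy0 nx p'x px0.
have [||y2 [y20 xy2]] := @match_pos_left (- p.1, - p.2) x y0 (extends_match_opp pM) xy0 nx.
- by rewrite /= derivN hornerN oppr_lt0.
- by rewrite /= hornerN px oppr0.
rewrite /= hornerN oppr_gt0 => py2.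
have y21 : y2 < y1.
  rewrite lt_neqAle (le_trans y20)// andbT.
  by apply: contraTneq py1 => <-; rewrite -leNgt ltW.
have [|y [/andP[y2y yy1] /rootP py]] := em_ivt2 pM y21; first by rewrite nmulr_rlt0.
exists y => //; apply/(matched_same2 _ xy2).
apply: (sm_convex2 EM) (_ : same_signs _ y2 y1); first by rewrite !ltW.
exact/(matched_same2 _ xy2).
Qed.

Lemma extension_left p x : extends_match E p ->
  exists2 y, matched E x y & sgz p.1.[x] = sgz p.2.[y].
Proof.
move=> pM; have [y0 xy0] := sm_left EM x.
have [[q qE [q0 qx]]|nx] := pselect (family_root1 E x).
  by exists y0 => //; exact: (em_root pM qE).
(* If p' vanishes at x, which is not a root of the family, then d = 0: p.1 and p.2 are constants of
   the same sign. *)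
have [p'0|p'x] := eqVneq (p.1)^`().[x] 0.
  have [d [e [dE pd1 pd2]]] := em_deriv pM.
  have d10 : d.1 = 0.
    apply/eqP; apply: contrapT => /negP d10; apply: nx; exists d => //; split=> //.
    by move/eqP: p'0; rewrite pd1 hornerZ mulf_eq0 signr_eq0.
  have d20 : d.2 = 0 by apply/eqP; rewrite -(sm_eq0 EM)// d10.
  by exists y0 => //; rewrite !horner_deriv0 ?(em_lead pM) ?pd1 ?pd2 ?d10 ?d20 ?scaler0.
have := p'x; case: (sgzP p.1.[x]) => px.
- have [y xy py] := match_zero pM xy0 nx p'x px; exists y => //.
  by rewrite py sgz0.
- have [y xy py] := match_pos pM xy0 nx p'x px; exists y => //.
  by rewrite gtr0_sgz.
- have [||y xy py] := @match_pos (- p.1, - p.2) _ _ (extends_match_opp pM) xy0 nx.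
  + by rewrite /= derivN hornerN oppr_eq0.
  + by rewrite /= hornerN oppr_gt0.
  by exists y => //; move: py; rewrite /= hornerN oppr_gt0 => /ltr0_sgz.
Qed.

End MatchPos.

Lemma sign_match_cons (F1 F2 : realFieldType) (E : seq ({poly F1} * {poly F2})) p :
  sign_match E -> extends_match E p -> sign_match (p :: E).
Proof.
move=> EM pM; have [d [e [dE pd1 pd2]]] := em_deriv pM.
have d1E : d.1 \in unzip1 E by apply/mapP; exists d.
have d2E : d.2 \in unzip2 E by apply/mapP; exists d.
have matched_cons x y : matched (p :: E) x y <->
    matched E x y /\ sgz p.1.[x] = sgz p.2.[y].
  split=> [xy|[xy pxy] q]; last by rewrite inE => /predU1P[->|/xy].
  by split=> [q qE|]; apply: xy; rewrite inE ?qE ?orbT ?eqxx.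
split.
- by move=> q; rewrite inE => /predU1P[->|]; [exact: em_eq0 pM|exact: (sm_eq0 EM)].
- by move=> q; rewrite inE => /predU1P[->|]; [exact: em_ivt1 pM|exact: (sm_ivt1 EM)].
- by move=> q; rewrite inE => /predU1P[->|]; [exact: em_ivt2 pM|exact: (sm_ivt2 EM)].
- exact: convex_sign_classes_cons (sm_convex1 EM) d1E pd1 (em_ivt1 pM).
- exact: convex_sign_classes_cons (sm_convex2 EM) d2E pd2 (em_ivt2 pM).
- by move=> x; have [y ? ?] := extension_left EM x pM; exists y; apply/matched_cons.
- move=> y; have EM' := sign_match_swap EM; have pM' := extends_match_swap EM pM.
  have [x /matched_swap ? /esym ?] := extension_left EM' y pM'.
  by exists x; apply/matched_cons.
move=> x x' y y' xx' /matched_cons[xy pxy] /matched_cons[x'y' px'y'] nxx'.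
(* In the new case only p separates x from x'. If y' <= y, p.1 on [x, x'] and p.2 on [y', y] are
   monotone in the same direction, which forces the signs of p.1 at x and x' to agree. *)
have [sxx'|/(sm_order EM xx' xy x'y')//] := pselect (same_signs (unzip1 E) x x').
have pxx' : sgz p.1.[x] != sgz p.1.[x'].
  apply: contra_notN nxx' => /eqP pxx' q; rewrite inE => /predU1P[->//|].
  exact: sxx'.
rewrite ltNge; apply/negP => y'y.
have sy'y : same_signs (unzip2 E) y' y.
  by apply/same_signs_sym/(matched_same xy x'y').
have [[p'0|xx]|[p'x mono1]|[p'x mono1]] :=
  convex_sign_monotone (sm_convex1 EM) d1E pd1 (em_ivt1 pM) (ltW xx') sxx'.
- by move: pxx'; rewrite !horner_deriv0// eqxx.
- by move: xx'; rewrite xx ltxx.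
- have [[p'0|yy]|[_ mono2]|[p'y _]] :=
    convex_sign_monotone (sm_convex2 EM) d2E pd2 (em_ivt2 pM) y'y sy'y.
  + by move: pxx'; rewrite pxy px'y' !horner_deriv0// eqxx.
  + by move: pxx'; rewrite pxy px'y' yy eqxx.
  + case/negP: pxx'; apply/eqP/le_anti; rewrite mono1 ?lexx ?(ltW xx')//=.
    by rewrite pxy px'y' mono2 ?lexx ?y'y.
  + move: p'y; rewrite -sgz_lt0 -(matched_deriv pM x'y') (same_signs_deriv1 pM sxx').
    by rewrite sgz_lt0 ltNge ltW.
- have [[p'0|yy]|[p'y _]|[_ mono2]] :=
    convex_sign_monotone (sm_convex2 EM) d2E pd2 (em_ivt2 pM) y'y sy'y.
  + by move: pxx'; rewrite pxy px'y' !horner_deriv0// eqxx.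
  + by move: pxx'; rewrite pxy px'y' yy eqxx.
  + move: p'y; rewrite -sgz_gt0 -(matched_deriv pM x'y') (same_signs_deriv1 pM sxx').
    by rewrite sgz_gt0 ltNge ltW.
  + case/negP: pxx'; apply/eqP/le_anti; apply/andP; split.
      by rewrite pxy px'y' mono2 ?lexx ?y'y.
    by rewrite mono1 ?lexx ?(ltW xx').
Qed.

(** The starting family; its member 0 serves as the derivative of constants. *)
Lemma sign_match0 (F1 F2 : realFieldType) : @sign_match F1 F2 [:: (0, 0)].
Proof.
have ivt0 F : @ivt_poly F 0 by move=> a b _; rewrite horner0 mul0r ltxx.
have all0 x y : @matched F1 F2 [:: (0, 0)] x y.
  by move=> q; rewrite inE => /eqP ->; rewrite !horner0 !sgz0.
split; do ?by move=> q; rewrite inE => /eqP ->; rewrite ?eqxx.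
- by move=> a b c _ _ q; rewrite inE => /eqP ->; rewrite !horner0.
- by move=> a b c _ _ q; rewrite inE => /eqP ->; rewrite !horner0.
- by move=> x; exists 0.
- by move=> y; exists 0.
by move=> x x' y y' _ _ _ []; move=> q; rewrite inE => /eqP ->; rewrite !horner0.
Qed.

(** * Specialization of finitely many signs *)

Section Truncation.
Variables (A : comNzRingType) (F : fieldType) (phi : {rmorphism A -> F}).
Implicit Types (p q : {poly A}).

(** Drops the top coefficients killed by [phi]: the image is unchanged, and [phi] now preserves the
    degree. *)
Definition truncate p := \poly_(i < size (map_poly phi p)) p`_i.

Definition degree_stable p := size (map_poly phi p) == size p.

Lemma map_truncate p : map_poly phi (truncate p) = map_poly phi p.
Proof.
apply/polyP => i; rewrite !coef_map coef_poly; case: ltnP => // ip.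
by rewrite raddf0 -coef_map nth_default.
Qed.

Lemma size_truncate p : size (truncate p) = size (map_poly phi p).
Proof.
have [p0|p0] := eqVneq (map_poly phi p) 0.
  by rewrite /truncate p0 size_poly0 poly_def big_ord0 size_poly0.
apply: size_poly_eq; apply: contraNneq p0 => p0.
by rewrite -lead_coef_eq0 lead_coefE coef_map p0 raddf0.
Qed.

Lemma degree_stable_truncate p : degree_stable (truncate p).
Proof. by rewrite /degree_stable map_truncate size_truncate. Qed.

Lemma truncate_degree_stable p : degree_stable p -> truncate p = p.
Proof.
move=> /eqP rp; apply/polyP => i; rewrite coef_poly rp.
by case: ltnP => // ip; rewrite nth_default.
Qed.

Lemma leq_size_truncate p : (size (truncate p) <= size p)%N.
Proof. by rewrite size_truncate size_poly. Qed.

Lemma degree_stable_eq0 p : degree_stable p -> (map_poly phi p == 0) = (p == 0).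
Proof. by move=> /eqP rp; rewrite -!size_poly_eq0 rp. Qed.

Lemma degree_stable_lead p : degree_stable p -> p != 0 -> phi (lead_coef p) != 0.
Proof.
move=> rp; rewrite -(degree_stable_eq0 rp) -lead_coef_eq0.
by rewrite !lead_coefE (eqP rp) coef_map.
Qed.

Lemma map_truncate_zero (C : nzRingType) (psi : {rmorphism A -> C}) p :
  (forall a, a \in (p : seq A) -> phi a = 0 -> psi a = 0) ->
  map_poly psi (truncate p) = map_poly psi p.
Proof.
move=> pz; apply/polyP => i; rewrite !coef_map coef_poly.
case: ltnP => // ip; rewrite raddf0; apply/esym.
have [psz|pi] := ltnP i (size p); last by rewrite nth_default ?raddf0.
by apply: pz; [exact: mem_nth|rewrite -coef_map nth_default].
Qed.

(** Here [Pdiv.Ring.rmodp p q] is the pseudo-remainder: modulo q it equals p times a power of the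
    leading coefficient of q. *)
Definition deriv_rem_closed (E : seq {poly A}) :=
  [/\ 0 \in E, {in E, forall p, degree_stable p}, {in E, forall p, truncate p^`() \in E} &
      {in E &, forall p q, q != 0 -> truncate (Pdiv.Ring.rmodp p q) \in E}].

(* Derivatives of, and remainders by, elements of size n.+1 have size at most n, so once the
   elements of H are processed only elements of size at most n are missing. *)
Lemma deriv_rem_saturate n (H W : seq {poly A}) :
  {in H, forall p, (n < size p)%N} -> {in W, forall p, (size p <= n)%N} ->
  {in H ++ W, forall p, degree_stable p} ->
  {in H, forall p, truncate p^`() \in H ++ W} ->
  {in H &, forall p q, q != 0 -> truncate (Pdiv.Ring.rmodp p q) \in H ++ W} ->
  exists E, {subset H ++ W <= E} /\ deriv_rem_closed E.
Proof.
elim: n => [|n IH] in H W * => szH szW reg Hd Hr.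
  exists (0 :: H ++ W); split=> [p pE|]; first by rewrite inE pE orbT.
  have W0 p : p \in 0 :: H ++ W -> p = 0 \/ p \in H.
    rewrite inE mem_cat => /or3P[/eqP|->|/szW]; [by left|by right|].
    by rewrite leqn0 size_poly_eq0 => /eqP; left.
  have r0 : degree_stable 0 by rewrite /degree_stable rmorph0 !size_poly0.
  split; first by rewrite inE eqxx.
  - by move=> p; rewrite inE => /predU1P[->//|]; exact: reg.
  - move=> p /W0[->|/Hd pE]; last by rewrite inE pE orbT.
    by rewrite deriv0 truncate_degree_stable// inE eqxx.
  - move=> p q /W0[->|pH] /W0[->|qH]; rewrite ?eqxx// => q0.
      by rewrite Pdiv.Ring.rmod0p truncate_degree_stable// inE eqxx.
    by rewrite inE Hr ?orbT.
pose H' := H ++ [seq p : {poly A} <- W | size p == n.+1].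
pose X := [seq p : {poly A} <- W | (size p <= n)%N] ++ [seq truncate p^`() | p <- H'] ++
  [seq truncate (Pdiv.Ring.rmodp p q) | p <- H', q <- H'].
pose W' := [seq p : {poly A} <- X | (size p <= n)%N].
have sub p : p \in H ++ W -> p \in H' ++ W'.
  rewrite !mem_cat !mem_filter !mem_cat => /orP[->//|pW].
  by have := szW p pW; rewrite leq_eqVlt ltnS => /orP[->|pn];
    rewrite ?mem_filter pW ?pn ?orbT.
have szH' p : p \in H' -> (n < size p)%N.
  rewrite mem_cat mem_filter => /orP[/szH/ltnW//|/andP[/eqP-> _]//].
have regH' p : p \in H' -> degree_stable p.
  rewrite mem_cat mem_filter => pH; apply: reg; rewrite mem_cat.
  by case/orP: pH => [->//|/andP[_ ->]]; rewrite orbT.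
have [|||||E [HE cE]] := IH H' W'; first exact: szH'.
- by move=> p; rewrite mem_filter => /andP[].
- move=> p; rewrite mem_cat => /orP[/regH'//|].
  rewrite mem_filter !mem_cat => /andP[_ /or3P[|/mapP[q _ ->]|/allpairsP[q [_ _ ->]]]].
  + by rewrite mem_filter => /andP[_ pW]; apply: reg; rewrite mem_cat pW orbT.
  + exact: degree_stable_truncate.
  + exact: degree_stable_truncate.
- move=> p pH'; have := pH'; rewrite mem_cat mem_filter => /orP[/Hd/sub//|/andP[/eqP sp _]].
  rewrite mem_cat mem_filter; apply/orP; right; apply/andP; split.
    rewrite (leq_trans (leq_size_truncate _))// -ltnS -sp lt_size_deriv//.
    by rewrite -size_poly_gt0 sp.
  by rewrite !mem_cat; apply/or3P; apply: Or32; apply/mapP; exists p.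
- move=> p q pH' qH' q0.
  (* If p is smaller than q, the remainder is p itself; if q has size n + 1, the remainder has size
     at most n; otherwise p and q are both in H. *)
  have [pq|qp] := ltnP (size p) (size q).
    by rewrite Pdiv.Ring.rmodp_small// truncate_degree_stable ?regH'// mem_cat pH'.
  have [sq|sq] := leqP (size q) n.+1.
    rewrite mem_cat mem_filter; apply/orP; right; apply/andP; split.
      rewrite (leq_trans (leq_size_truncate _))// -ltnS (leq_trans _ sq)//.
      exact: Pdiv.Ring.ltn_rmodpN0.
    by rewrite !mem_cat; apply/or3P; apply: Or33; apply/allpairsP; exists (p, q).
  have big r : r \in H' -> (n.+1 < size r)%N -> r \in H.
    by rewrite mem_cat mem_filter => /orP[//|/andP[/eqP->]]; rewrite ltnn.
  by apply/sub/Hr => //; apply: big => //; exact: leq_trans qp.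
by exists E; split=> // p /sub/HE.
Qed.

Lemma deriv_rem_closure (S : seq {poly A}) :
  exists E, {subset map truncate S <= E} /\ deriv_rem_closed E.
Proof.
pose n := \max_(p <- map truncate S) size p.
have [|||||E [SE cE]] := @deriv_rem_saturate n [::] (map truncate S) => //.
- move=> p pS; rewrite /n (big_rem p)//=; exact: leq_maxl.
- by move=> _ /mapP[p _ ->]; exact: degree_stable_truncate.
by exists E.
Qed.

End Truncation.

Lemma truncate_comp (A : comNzRingType) (F F' : fieldType)
    (phi : {rmorphism A -> F}) (iota : {rmorphism F -> F'}) p :
  truncate (iota \o phi) p = truncate phi p.
Proof. by rewrite /truncate map_poly_comp size_map_poly. Qed.

(** The closure can thus be formed first, and the field then enlarged to give its members the
    intermediate value property. *)
Lemma deriv_rem_closed_comp (A : comNzRingType) (F F' : fieldType)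
    (phi : {rmorphism A -> F}) (iota : {rmorphism F -> F'}) E :
  deriv_rem_closed phi E -> deriv_rem_closed (iota \o phi) E.
Proof.
move=> [E0 Er Ed Em]; split=> //.
- by move=> p /Er; rewrite /degree_stable map_poly_comp size_map_poly.
- by move=> p /Ed; rewrite truncate_comp.
- by move=> p q pE qE /(Em p q pE qE); rewrite truncate_comp.
Qed.

(** * Transfer of sign vectors from one field to another *)

Section FamilyTransfer.
Variables (A : comNzRingType) (F1 F2 : realFieldType).
Variables (phi1 : {rmorphism A -> F1}) (phi2 : {rmorphism A -> F2}).
Implicit Types (p q : {poly A}) (E M : seq {poly A}).

Definition signs_agree (s : seq A) := {in s, forall a, sgz (phi1 a) = sgz (phi2 a)}.

Local Notation pair_map := (fun p => (map_poly phi1 p, map_poly phi2 p)).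

Lemma map_truncate_agree p : signs_agree p ->
  map_poly phi2 (truncate phi1 p) = map_poly phi2 p.
Proof.
move=> ps; apply: map_truncate_zero => a ap a0; apply/eqP.
by rewrite -sgz_eq0 -ps// a0 sgz0.
Qed.

Lemma sgz_lead_agree p : signs_agree p -> p != 0 ->
  sgz (phi1 (lead_coef p)) = sgz (phi2 (lead_coef p)).
Proof.
move=> ps p0; apply: ps; rewrite lead_coefE; apply: mem_nth.
by rewrite prednK ?size_poly_gt0.
Qed.

Lemma degree_stable_agree p : signs_agree p -> degree_stable phi1 p -> p != 0 ->
  [/\ size (map_poly phi1 p) = size (map_poly phi2 p),
      lead_coef (map_poly phi1 p) = phi1 (lead_coef p) &
      lead_coef (map_poly phi2 p) = phi2 (lead_coef p)].
Proof.
move=> ps rp p0; have l1 := degree_stable_lead rp p0.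
have l2 : phi2 (lead_coef p) != 0 by rewrite -sgz_eq0 -sgz_lead_agree// sgz_eq0.
by split; rewrite ?lead_coef_map_eq// !size_map_poly_id0.
Qed.

(** At a root of q the sign of p can be read off from that of the remainder and of the leading
    coefficient of q. *)
Lemma map_rdivp_eq (C : comNzRingType) (psi : {rmorphism A -> C}) p q x :
  root (map_poly psi q) x ->
  psi (lead_coef q) ^+ Pdiv.Ring.rscalp p q * (map_poly psi p).[x] =
  (map_poly psi (Pdiv.Ring.rmodp p q)).[x].
Proof.
move=> /rootP qx; have := congr1 (fun u => (map_poly psi u).[x]) (Pdiv.ComRing.rdivp_eq q p).
by rewrite /= rmorphD rmorphM /= map_polyZ/= hornerZ hornerD hornerM qx mulr0 add0r rmorphXn.
Qed.

Variable E : seq {poly A}.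
Hypothesis E_closed : deriv_rem_closed phi1 E.
Hypothesis E_ivt1 : {in E, forall p, ivt_poly (map_poly phi1 p)}.
Hypothesis E_ivt2 : {in E, forall p, ivt_poly (map_poly phi2 p)}.
Hypothesis E_signs : {in E, forall p, signs_agree p}.
Hypothesis E_signs_deriv : {in E, forall p, signs_agree p^`()}.
Hypothesis E_signs_rem : {in E &, forall p q, signs_agree (Pdiv.Ring.rmodp p q)}.

Lemma family_extends p M : p \in E -> p != 0 -> {subset M <= E} ->
  {in E, forall q, (size q < size p)%N -> q \in M} ->
  {in M, forall q, (size q <= size p)%N} ->
  extends_match [seq pair_map q | q <- M] (pair_map p).
Proof.
have [_ Er Ed Em] := E_closed => pE p0 ME Mlt Mle.
have [sz l1 l2] := degree_stable_agree (E_signs pE) (Er p pE) p0.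
split=> //=.
- by rewrite l1 l2; exact: sgz_lead_agree (E_signs pE) p0.
- exact: E_ivt1.
- exact: E_ivt2.
- exists (pair_map (truncate phi1 p^`())), false; split.
  + apply: map_f; apply: Mlt; first exact: Ed.
    by rewrite (leq_ltn_trans (leq_size_truncate _ _))// lt_size_deriv.
  + by rewrite /signed_deriv expr0 scale1r /= map_truncate deriv_map.
  + by rewrite /signed_deriv expr0 scale1r /= map_truncate_agree ?deriv_map//; exact: E_signs_deriv.
- move=> _ x y /mapP[q qM ->] /= q10 qx qxy.
  have qE := ME q qM.
  have q0 : q != 0 by rewrite -(degree_stable_eq0 (Er q qE)).
  have qy : root (map_poly phi2 q) y.
    have := qxy (pair_map q) (map_f pair_map qM); rewrite /= (rootP qx) sgz0.
    by move=> /esym/eqP; rewrite sgz_eq0.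
  (* The remainder is smaller than q, hence smaller than p, and so already belongs to M. *)
  have rM : truncate phi1 (Pdiv.Ring.rmodp p q) \in M.
    apply: Mlt; first exact: Em.
    rewrite (leq_ltn_trans (leq_size_truncate _ _))//.
    by rewrite (leq_trans _ (Mle q qM))// Pdiv.Ring.ltn_rmodpN0.
  have := qxy _ (map_f pair_map rM); rewrite /= map_truncate.
  rewrite map_truncate_agree; last exact: E_signs_rem.
  rewrite -!map_rdivp_eq// !sgzM !sgzX (sgz_lead_agree (E_signs qE) q0).
  apply/mulfI/expf_neq0; rewrite -(sgz_lead_agree (E_signs qE) q0) sgz_eq0.
  exact: degree_stable_lead (Er q qE) q0.
Qed.

(** The members of E are added by increasing size, so that the derivative of p and its remainders by
    earlier members are present before p. *)
Lemma family_sign_match n : exists M, [/\ {subset M <= E},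
  {in E, forall p, (size p <= n)%N -> p \in M}, {in M, forall p, (size p <= n)%N} &
  sign_match [seq pair_map q | q <- M]].
Proof.
have [E0 _ _ _] := E_closed.
elim: n => [|n [M [ME Mlt Mle Mm]]].
  exists [:: 0]; split.
  - by move=> p; rewrite inE => /eqP->.
  - by move=> p _; rewrite leqn0 size_poly_eq0 inE.
  - by move=> p; rewrite inE => /eqP->; rewrite size_poly0.
  - by rewrite /= !rmorph0; exact: sign_match0.
suff H W : {subset W <= [seq p : {poly A} <- E | size p == n.+1]} ->
    sign_match [seq pair_map q | q <- W ++ M].
  exists ([seq p : {poly A} <- E | size p == n.+1] ++ M); split; last exact: H.
  - by move=> p; rewrite mem_cat mem_filter => /orP[/andP[]|/ME].
  - move=> p pE; rewrite leq_eqVlt ltnS mem_cat mem_filter pE andbT.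
    by move=> /orP[->//|/(Mlt p pE)->]; rewrite orbT.
  - by move=> p; rewrite mem_cat mem_filter => /orP[/andP[/eqP->]//|/Mle/leqW].
elim: W => [//|p W IH] /= sW.
have WE q : q \in W -> q \in E /\ size q = n.+1.
  by move=> qW; have := sW q; rewrite inE qW orbT mem_filter => /(_ isT) /andP[/eqP].
have [/eqP szp pE] : size p == n.+1 /\ p \in E.
  by have := sW p; rewrite inE eqxx mem_filter => /(_ isT) /andP[].
apply: sign_match_cons; first by apply: IH => q qW; apply: sW; rewrite inE qW orbT.
apply: family_extends => //.
- by rewrite -size_poly_eq0 szp.
- by move=> q; rewrite mem_cat => /orP[/WE[]|/ME].
- by move=> q qE; rewrite szp ltnS mem_cat => /(Mlt q qE)->; rewrite orbT.
- by move=> q; rewrite szp mem_cat => /orP[/WE[_ ->]|/Mle/leqW].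
Qed.

Lemma family_transfer x :
  exists y, {in E, forall p, sgz (map_poly phi1 p).[x] = sgz (map_poly phi2 p).[y]}.
Proof.
have [M [ME Mall _ Mm]] := family_sign_match (\max_(p <- E) size p).
have [y xy] := sm_left Mm x; exists y => p pE.
apply: (xy (pair_map p)); apply: (map_f pair_map); apply: Mall => //.
by rewrite (big_rem p)//=; exact: leq_maxl.
Qed.

End FamilyTransfer.

(** The Artin-Lang property of A over R: finitely many signs taken at a point of the real spectrum
    are also taken at an R-point. *)
Definition specializable (R : rcfType) (A : comNzRingType) (c : {rmorphism R -> A}) :=
  forall (L : realFieldType) (phi : {rmorphism A -> L}) (S : seq A),
  exists psi : {rmorphism A -> R},
    (forall r, psi (c r) = r) /\ {in S, forall a, sgz (psi a) = sgz (phi a)}.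

Lemma nonneg_morph_sgz (F F' : realFieldType) (iota : {rmorphism F -> F'}) x :
  nonneg_morph iota -> sgz (iota x) = sgz x.
Proof.
move=> iP; case: (sgzP x) => [->|x0|x0].
- by rewrite rmorph0 sgz0.
- by apply: gtr0_sgz; rewrite lt0r fmorph_eq0 gt_eqF//= iP// ltW.
- apply: ltr0_sgz; rewrite -oppr_gt0 -rmorphN lt0r fmorph_eq0 oppr_eq0 lt_eqF//=.
  by rewrite iP// oppr_ge0 ltW.
Qed.

(** Nonnegative elements of a real closed field are squares, so every ring morphism to an ordered
    field preserves signs. *)
Lemma specializable_base (R : rcfType) : @specializable R R idfun.
Proof.
move=> L phi S; exists idfun; split=> // r _; apply/esym/nonneg_morph_sgz.
by move=> x x0; rewrite -(sqr_sqrtr x0) rmorphXn sqr_ge0.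
Qed.

(** The coefficients of the closed family, its derivatives and remainders are specialized by the
    hypothesis on A. Sign transfer then moves the image of ['X] to a point y of R, and psi is
    extended by evaluation at y. *)
Lemma specializable_poly (R : rcfType) (A : comNzRingType) (c : {rmorphism R -> A}) :
  specializable c -> specializable (polyC \o c).
Proof.
move=> cA L phi S; pose phiA := phi \o polyC.
have [E [SE cE]] := deriv_rem_closure phiA S.
have [F1 [iota [i_ge0 ivt1]]] := ivt_extension [seq map_poly phiA p | p <- E].
pose phi1 := iota \o phiA.
pose rems := [seq Pdiv.Ring.rmodp p q | p <- E, q <- E].
pose T := flatten [seq polyseq p | p <- S ++ E ++ [seq p^`() | p <- E] ++ rems].
have [psi [psi_c psiT]] := cA L phiA T.
have agree p : p \in S ++ E ++ [seq p^`() | p <- E] ++ rems -> signs_agree phi1 psi p.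
  move=> pT a ap; rewrite psiT; first exact: nonneg_morph_sgz.
  by apply/flattenP; exists (polyseq p) => //; apply/mapP; exists p.
have [|||||y xy] := @family_transfer A F1 R phi1 psi E
    (deriv_rem_closed_comp iota cE) _ _ _ _ _ (iota (phi 'X)).
- by move=> p pE; rewrite /phi1 map_poly_comp; apply: ivt1; exact: map_f.
- move=> p pE a b ab pab; have [z zab pz] := poly_ivtoo (ltW ab) pab.
  by exists z; rewrite in_itv /= in zab.
- by move=> p pE; apply: agree; rewrite !mem_cat pE orbT.
- by move=> p pE; apply: agree; rewrite !mem_cat map_f ?orbT.
- by move=> p q pE qE; apply: agree; rewrite !mem_cat (allpairs_f _ pE qE) !orbT.
exists (horner_eval y \o map_poly psi); split.
  by move=> r; rewrite /= map_polyC /= /horner_eval hornerC psi_c.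
move=> p pS; rewrite /= /horner_eval.
(* E contains p only without its top coefficients killed by phi; psi kills these too, so both images
   are those of p. *)
have ptr : truncate phiA p \in E by apply: SE; exact: map_f.
have := xy _ ptr.
rewrite -(truncate_comp phiA iota) map_truncate map_truncate_agree; last first.
  by apply: agree; rewrite mem_cat pS.
move=> <-; rewrite /phi1 map_poly_comp horner_map /= nonneg_morph_sgz//.
by congr (sgz _); exact: rmorph_poly_horner.
Qed.

(** * Positive functionals and the real Nullstellensatz *)

Section PositiveFunctional.
Variables (R : rcfType) (B : comNzRingType) (c : {rmorphism R -> B}).
Variable ell : {additive B -> R}.
Hypothesis ellZ : forall r t, ell (c r * t) = r * ell t.
Hypothesis ell_sqr : forall t, 0 <= ell (t ^+ 2).

(** The largest ideal contained in the kernel of [ell]. *)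
Definition null_ideal : set B := [set t | forall u, ell (t * u) = 0].

(* Cauchy-Schwarz *)
Lemma null_sqr t : ell (t ^+ 2) = 0 -> null_ideal t.
Proof.
move=> t0 u; apply: contrapT => /eqP tu0.
have key r : 0 <= ell (u ^+ 2) + 2 * r * ell (t * u).
  have := ell_sqr (c r * t + u); congr (_ <= _).
  have -> : (c r * t + u) ^+ 2 = c (r ^+ 2) * t ^+ 2 + (c (2 * r) * (t * u) + u ^+ 2).
    by rewrite rmorphXn rmorphM rmorph_nat; ring.
  by rewrite !raddfD /= !ellZ t0; ring.
(* The r^2 term has dropped out, so the bound is affine in r; it equals - 1 at this r. *)
have := key (- (ell (u ^+ 2) + 1) / (2 * ell (t * u))).
rewrite (_ : _ + _ = - 1); last by field.
by rewrite oppr_ge0 ler10.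
Qed.

(** As (f^(m+1))^2 = f^(m+2) f^m, the exponent can be lowered by one at a time. *)
Lemma null_of_pow f m : null_ideal (f ^+ m.+1) -> null_ideal f.
Proof.
elim: m => [|m IH fm]; first by rewrite expr1.
apply/IH/null_sqr; rewrite (_ : _ ^+ 2 = f ^+ m.+2 * f ^+ m) ?fm//.
by rewrite -!exprD -exprM; congr (_ ^+ _); lia.
Qed.

Lemma ell_sos s : weighted_sos [set 1] s -> 0 <= ell s.
Proof.
by elim=> [|_ a s' -> _ IH]; rewrite ?raddf0// mul1r raddfD addr_ge0.
Qed.

(* The null ideal is real. If ell f <> 0, no power of f lies in it, so some ring homomorphism
   to an ordered field kills g but not f, and it can be specialized to R. *)
Lemma positive_functional_nullstellensatz g f : specializable c -> null_ideal g ->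
  (forall psi : {rmorphism B -> R}, (forall r, psi (c r) = r) -> psi g = 0 -> psi f = 0) ->
  ell f = 0.
Proof.
move=> cB ng gf; apply: contrapT => f0.
pose T : set B := [set t | exists s j, [/\ weighted_sos [set 1] s, null_ideal j & t = s + j]].
have n0 : null_ideal 0 by move=> u; rewrite mul0r raddf0.
have TT : preordering T.
  split.
  - move=> _ _ [s [j [sS nj ->]]] [s' [j' [sS' nj' ->]]].
    exists (s + s'), (j + j'); split; [exact: weighted_sosD| |ring].
    by move=> u; rewrite mulrDl raddfD /= nj nj' addr0.
  - move=> _ _ [s [j [sS nj ->]]] [s' [j' [sS' nj' ->]]].
    exists (s * s'), (j * s' + j' * (s + j)); split; [|  |ring].
      by apply: weighted_sosM => // _ _ -> ->; rewrite /= mulr1.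
    by move=> u; rewrite mulrDl raddfD /= -!mulrA nj nj' addr0.
  - move=> a; exists (a ^+ 2), 0; rewrite addr0; split=> //.
    by rewrite -[_ ^+ 2]mul1r; exact: weighted_sos_sqr.
have fT : avoids_powers f T.
  move=> m [s [j [sS nj e]]]; apply: f0.
  (* From - f^(2m) = s + j follows [ell] (f^(2m)) <= 0, hence equality. *)
  have fm : null_ideal (f ^+ m).
    apply/null_sqr/le_anti; rewrite ell_sqr andbT -oppr_ge0 -raddfN /= e raddfD /=.
    by have := nj 1; rewrite mulr1 => ->; rewrite addr0 ell_sos.
  rewrite -[f]mulr1; apply: (@null_of_pow f m).
  by move=> u; rewrite exprSr -mulrA fm.
have [L [phi [phiT phif]]] := exists_ordered_field TT fT.
have [psi [psi_c psiS]] := cB L phi [:: f; g].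
suff psig : psi g = 0.
  move: phif; rewrite -sgz_eq0 -psiS ?inE ?eqxx//.
  by rewrite (gf psi psi_c psig) sgz0 eqxx.
apply/eqP; rewrite -sgz_eq0 psiS ?inE ?eqxx ?orbT// sgz_eq0.
rewrite eq_le -oppr_ge0 -rmorphN; apply/andP; split; apply: phiT.
  exists 0, (- g); split; rewrite ?add0r//; first exact: WSos0.
  by move=> u; rewrite mulNr raddfN /= ng oppr0.
by exists 0, g; rewrite add0r; split=> //; exact: WSos0.
Qed.

End PositiveFunctional.

(** Polynomials in n variables as iterated univariate ones, the last variable outermost, so that
    [specializable_poly] can be iterated. *)
Fixpoint poly_tower (R : comNzRingType) (n : nat) : comNzRingType :=
  if n is m.+1 then {poly poly_tower R m} else R.

Fixpoint tower_const (R : comNzRingType) n : {rmorphism R -> poly_tower R n} :=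
  if n is m.+1 then polyC \o tower_const R m else idfun.

Fixpoint tower_var (R : comNzRingType) n (i : nat) : poly_tower R n :=
  if n is m.+1 then (if i == m then 'X else (tower_var R m i)%:P) else 0.

Fixpoint tower_eval (R C : comNzRingType) (k : {rmorphism R -> C}) (x : nat -> C) n :
    {rmorphism poly_tower R n -> C} :=
  if n is m.+1 then horner_eval (x m) \o map_poly (tower_eval k x m) else k.

Section PolyTower.
Variables (R C : comNzRingType) (k : {rmorphism R -> C}) (x : nat -> C).

Lemma tower_eval_const n r : tower_eval k x n (tower_const R n r) = k r.
Proof. by elim: n => //= n IH; rewrite map_polyC /horner_eval hornerC. Qed.

Lemma tower_eval_var n i : (i < n)%N -> tower_eval k x n (tower_var R n i) = x i.
Proof.
elim: n => //= n IH; rewrite ltnS leq_eqVlt; case: eqVneq => [-> _|_ /= /IH e].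
  by rewrite /horner_eval map_polyX hornerX.
by rewrite map_polyC /horner_eval hornerC.
Qed.

Lemma tower_ext n (f g : {rmorphism poly_tower R n -> C}) :
  (forall r, f (tower_const R n r) = g (tower_const R n r)) ->
  (forall i, (i < n)%N -> f (tower_var R n i) = g (tower_var R n i)) -> f =1 g.
Proof.
elim: n f g => //= n IH f g fgc fgv p.
rewrite -(rmorph_poly_horner f p) -(rmorph_poly_horner g p).
have -> : f 'X = g 'X by have := fgv n (ltnSn n); rewrite eqxx.
congr (_.[_]); apply: eq_map_poly; apply: IH => [r|i ilt]; first exact: fgc.
by have := fgv i (ltnW ilt); rewrite (ltn_eqF ilt).
Qed.

End PolyTower.

Lemma specializable_tower (R : rcfType) n : specializable (tower_const R n).
Proof. by elim: n => [|n IH]; [exact: specializable_base|exact: specializable_poly]. Qed.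

(** * Real polynomials inside the complex ones *)

Section RealPolynomials.
Variables (R : realType) (n : nat).
Local Notation B := (poly_tower R n).

Definition real_const : {rmorphism R -> cpoly R n} :=
  @mpolyC n (complex R) \o real_complex R.

(** Extended by 0 beyond n, since [tower_eval] takes a sequence indexed by [nat]. *)
Definition cpoly_var (i : nat) : cpoly R n :=
  if insub i is Some j then mpolyX (complex R) (mnm1 j) else 0.

Definition real_cpoly : {rmorphism B -> cpoly R n} := tower_eval real_const cpoly_var n.

Lemma real_cpoly_const r : real_cpoly (tower_const R n r) = mpolyC n (real_complex R r).
Proof. exact: tower_eval_const. Qed.

Lemma real_cpoly_var (i : 'I_n) : real_cpoly (tower_var R n i) = mpolyX (complex R) (mnm1 i).
Proof. by rewrite /real_cpoly tower_eval_var// /cpoly_var valK. Qed.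

Lemma cpoly_split (Q : cpoly R n) : exists a b : B,
  Q = real_cpoly a + mpolyC n (Complex 0 1) * real_cpoly b.
Proof.
elim/mpolyind: Q => [|c m Q _ _ [a [b ->]]].
  by exists 0, 0; rewrite rmorph0 mulr0 addr0.
pose t : B := \prod_(i < n) tower_var R n i ^+ m i.
have -> : mpolyX (complex R) m = real_cpoly t.
  rewrite mpolyXE_id rmorph_prod; apply: eq_bigr => i _.
  by rewrite rmorphXn real_cpoly_var.
exists (tower_const R n (complex.Re c) * t + a), (tower_const R n (complex.Im c) * t + b).
rewrite -mul_mpolyC {1}[c]complexE mpolyCD mpolyCM !rmorphD !rmorphM !real_cpoly_const.
by ring.
Qed.

Lemma star_real_cpoly a : star (real_cpoly a) = real_cpoly a.
Proof.
rewrite /star.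
have := @tower_ext R (cpoly R n) n (map_mpoly Num.conj \o real_cpoly) real_cpoly.
apply => [r|i ilt] /=.
  rewrite real_cpoly_const map_mpolyC; congr mpolyC.
  exact: conjc_real.
by rewrite (real_cpoly_var (Ordinal ilt)) map_mpolyX.
Qed.

Lemma star_split a b : star (real_cpoly a + mpolyC n (Complex 0 1) * real_cpoly b) =
  real_cpoly a - mpolyC n (Complex 0 1) * real_cpoly b.
Proof.
rewrite -[in RHS](star_real_cpoly a) -[in RHS](star_real_cpoly b).
rewrite /star rmorphD rmorphM /= map_mpolyC -mulNr -mpolyCN; congr (_ + mpolyC _ _ * _).
by rewrite -[LHS]/(Complex 0 (- 1)) -[RHS]/(Complex (- 0) (- 1)) oppr0.
Qed.

(** Turns specializations into points of R^n: psi is evaluation at the point whose coordinates are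
    the images of the variables. *)
Lemma eval_real_cpoly (psi : {rmorphism B -> R}) a : (forall r, psi (tower_const R n r) = r) ->
  eval_real (real_cpoly a) (\row_(i < n) psi (tower_var R n i)) = real_complex R (psi a).
Proof.
move=> psi_c; rewrite /eval_real.
set v := fun j => _.
apply: (@tower_ext R (complex R) n (meval v \o real_cpoly) (real_complex R \o psi)) => [r|i ilt] /=.
  by rewrite real_cpoly_const mevalC psi_c.
by rewrite (real_cpoly_var (Ordinal ilt)) mevalXU /v mxE.
Qed.

End RealPolynomials.

(** * The real functional attached to Lambda *)

Section RealPartFunctional.
Variables (R : realType) (n : nat) (Lambda : {scalar cpoly R n}).
Local Notation B := (poly_tower R n).

Definition real_part_functional (t : B) : R := complex.Re (Lambda (real_cpoly R n t)).

Fact real_part_functional_zmod : zmod_morphism real_part_functional.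
Proof.
move=> t u; rewrite /real_part_functional !rmorphB raddfB /=.
by case: (Lambda _) => ? ?; case: (Lambda _).
Qed.

HB.instance Definition _ :=
  GRing.isZmodMorphism.Build B R real_part_functional real_part_functional_zmod.

Lemma real_part_functionalZ r t :
  real_part_functional (tower_const R n r * t) = r * real_part_functional t.
Proof.
rewrite /real_part_functional rmorphM real_cpoly_const mul_mpolyC linearZ /=.
by case: (Lambda _) => x y; rewrite /= mul0r subr0.
Qed.

Hypothesis Lambda_pos : positive_definite Lambda.

Lemma Lambda_real_sqr t : 0 <= Lambda (real_cpoly R n (t ^+ 2)).
Proof. by have := Lambda_pos (real_cpoly R n t); rewrite star_real_cpoly expr2 rmorphM. Qed.

Lemma real_part_functional_sqr t : 0 <= real_part_functional (t ^+ 2).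
Proof. by have := Lambda_real_sqr t; rewrite lecE => /andP[]. Qed.

Lemma Lambda_real t : Lambda (real_cpoly R n t) = real_complex R (real_part_functional t).
Proof.
pose im u := complex.Im (Lambda (real_cpoly R n u)).
have imB u v : im (u - v) = im u - im v.
  by rewrite /im rmorphB raddfB /=; case: (Lambda _) => ? ?; case: (Lambda _).
have im_sqr u : im (u ^+ 2) = 0.
  by have := Lambda_real_sqr u; rewrite lecE => /andP[/eqP].
have im0 : im 0 = 0 by rewrite -(subrr (0 : B)) imB subrr.
(* The imaginary part is additive and vanishes on squares, and 2 t = (t + 1)^2 - t^2 - 1^2. *)
have : im (t - (0 - t)) = im ((t + 1) ^+ 2 - t ^+ 2 - 1 ^+ 2) by congr im; ring.
rewrite !imB !im_sqr im0 => imt.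
have {}imt : im t = 0 by lra.
by rewrite [LHS]complexE -/(im t) imt rmorph0 mulr0 addr0.
Qed.

(** With P = a + ib and Q = c + id, the polynomial g = a^2 + b^2 = P^*P has the real zeros of P, and
    its multiples lie in the ideal of P. The Nullstellensatz applies to g with c and with d. *)
Lemma positive_definite_vanishing P :
  vanishes_on Lambda (principal_ideal P) ->
  vanishes_on Lambda (vanishing_ideal (real_zeros P)).
Proof.
move=> LP Q QP; have [a [b eP]] := cpoly_split P; have [c [d eQ]] := cpoly_split Q.
pose g := a ^+ 2 + b ^+ 2.
have gP : real_cpoly R n g = star P * P.
  rewrite eP star_split /g rmorphD !rmorphXn.
  have -> : forall u v w : cpoly R n, (u - w * v) * (u + w * v) = u ^+ 2 - (w * w) * v ^+ 2.
    by move=> u v w; ring.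
  rewrite -mpolyCM (_ : Complex 0 1 * Complex 0 1 = -1) ?mpolyCN ?mpolyC1.
    by rewrite mulN1r opprK.
  by rewrite -expr2 sqr_i.
have g_null : null_ideal real_part_functional g.
  move=> u; rewrite /= /real_part_functional rmorphM gP mulrC mulrA LP//.
  by exists (real_cpoly R n u * star P).
have zero (psi : {rmorphism B -> R}) : (forall r, psi (tower_const R n r) = r) ->
    psi g = 0 -> psi c = 0 /\ psi d = 0.
  move=> psi_c; rewrite /g rmorphD !rmorphXn => /eqP.
  rewrite paddr_eq0 ?sqr_ge0// !sqrf_eq0 => /andP[/eqP psia /eqP psib].
  have ev u v : eval_real (real_cpoly R n u + mpolyC n (Complex 0 1) * real_cpoly R n v)
      (\row_(i < n) psi (tower_var R n i)) = Complex (psi u) (psi v).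
    rewrite /eval_real mevalD mevalM mevalC.
    rewrite -!/(eval_real _ _) !eval_real_cpoly//.
    by rewrite [RHS]complexE.
  have := QP (\row_(i < n) psi (tower_var R n i)).
  rewrite /real_zeros /= eP eQ !ev psia psib => /(_ erefl).
  by move=> [-> ->].
have ell0 f : (f = c \/ f = d) -> real_part_functional f = 0.
  move=> fcd; apply: (@positive_functional_nullstellensatz R B (tower_const R n)
    real_part_functional real_part_functionalZ real_part_functional_sqr g f
    (@specializable_tower R n) g_null).
  by move=> psi psi_c /(zero psi psi_c)[? ?]; case: fcd => ->.
rewrite eQ mul_mpolyC raddfD /= linearZ /= !Lambda_real.
by rewrite (ell0 c) ?(ell0 d) ?rmorph0 ?mulr0 ?addr0; [| right | left].
Qed.

End RealPartFunctional.

Theorem theorem4p5 (R : realType) (n : nat) (hn : (1 <= n)%N)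
  (P : cpoly R n) : type_A P <-> type_B P.
Proof.
(* Each type is applied to Lambda itself, so only the two vanishing conditions are compared. *)
split=> typeP Lambda Lpos LP; apply: typeP => //.
  by move=> _ [S _ <-]; apply: LP => x /= Px; rewrite /eval_real mevalM [X in _ * X]Px mulr0.
exact: positive_definite_vanishing.
Qed.
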